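(* Assume that $K$ has characteristic $0$ and residue characteristic $p\ge 0$. Let $\phi\in K(z)$ have degree $d\ge 2$, let $\mathcal L_\phi$ denote the Lipschitz constant for the action of $\phi$ on $\mathbb P^1(K)$ with respect to the chordal metric (one has $\mathcal L_\phi\ge 1$), and let $\tilde{\mathcal L}_\phi>\mathcal L_\phi$. There exists a constant $N_0=N_0(\phi)$ depending only on $\phi$ such that if $n\ge N_0$ is a positive integer and $P\in\mathbf H^1_K$ is a point with $w_{\phi^n}(P)>0$, then $$\rho(P,\zeta_G)<3n\log_v\tilde{\mathcal L}_\phi .$$
   Context: $K$ is an algebraically closed field, complete with respect to a nontrivial non-Archimedean absolute value $|\cdot|$, with ring of integers $\mathcal O$ and residue field $k$; $\log_v$ is the logarithm to a fixed base $q_v>1$. Berkovich line: $\mathbf P^1_K$ is the Berkovich projective line over $K$, $\mathbf H^1_K=\mathbf P^1_K\setminus\mathbb P^1(K)$. $\zeta_{a,r}$ is the point given by the sup-norm on the disc $D(a,r)=\{|z-a|\le r\}$, and $\zeta_G=\zeta_{0,1}$. Type I points are those of $\mathbb P^1(K)$; type II points are the $\zeta_{a,r}$ with $r\in|K^\times|$; type III points are the $\zeta_{a,r}$ with $r>0$, $r\notin|K^\times|$; the rest are type IV. A rational map acts on $\mathbf P^1_K$ in the usual way. $x\wedge y$ is the unique point common to the paths $[x,y],[x,\zeta_G],[y,\zeta_G]$. $\mathrm{diam}_{\zeta_G}(\zeta_{a,r})=r$ if $D(a,r)\subseteq D(0,1)$ (extended by limits to type IV points), and $\mathrm{diam}_{\zeta_G}(x)=\mathrm{diam}_{\zeta_G}(1/x)$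 if $x$ lies in the component of $\mathbf P^1_K\setminus\{\zeta_G\}$ containing $\infty$. On $\mathbf H^1_K$, $\rho(x,y)=2\log_v\mathrm{diam}_{\zeta_G}(x\wedge y)-\log_v\mathrm{diam}_{\zeta_G}(x)-\log_v\mathrm{diam}_{\zeta_G}(y)$. Chordal metric: $\|x,y\|=\dfrac{|x_1y_2-x_2y_1|}{\max(|x_1|,|x_2|)\max(|y_1|,|y_2|)}$ for $x=[x_1:x_2]$, $y=[y_1:y_2]\in\mathbb P^1(K)$. $\mathcal L_\phi=\sup_{x\ne y}\|\phi(x),\phi(y)\|/\|x,y\|$. Weights: for $P\in\mathbf P^1_K$, $T_P$ is the set of tangent directions at $P$, and for $\vec v\in T_P$, $B_{\vec v}(P)^-$ is the corresponding component of $\mathbf P^1_K\setminus\{P\}$. Let $\psi\in K(z)$ have degree $\ge2$ (applied with $\psi=\phi^n$). If $P$ is a type II point fixed by $\psi$, choose $\gamma\in\mathrm{PGL}_2(K)$ with $\gamma(\zeta_G)=P$ and put $\psi^\gamma=\gamma^{-1}\circ\psi\circ\gamma$; write $\psi^\gamma=f/g$ with $f,g$ coprime polynomials over $\mathcal O$, at least one coefficient being a unit, reduce coefficients to $k$ and cancel common factors to obtain a nonconstant map $\widetilde{\psi^\gamma}\in k(z)$. Then $\deg_\psi(P)=\deg\widetilde{\psi^\gamma}$, and $\psi_*:T_P\to T_P$ is the map induced by $\widetilde{\psi^\gamma}$ on $T_P\cong\mathbb P^1(k)$. A direction $\vec v\in T_P$ is shearing if $B_{\vec v}(P)^-$ contains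 a type I fixed point of $\psi$ but $\psi_*\vec v\ne\vec v$; $N_{\mathrm{Shearing}}(P)$ is the number of shearing directions. $\Gamma_{\mathrm{Fix}}$ is the tree in $\mathbf P^1_K$ spanned by the type I fixed points of $\psi$, and $v_{\Gamma_{\mathrm{Fix}}}(P)$ is the valence of $P$ in it ($0$ if $P\notin\Gamma_{\mathrm{Fix}}$). The weight $w_\psi(P)$ is: $\deg_\psi(P)-1+N_{\mathrm{Shearing}}(P)$ if $P$ is type II and fixed by $\psi$; $\max(0,v_{\Gamma_{\mathrm{Fix}}}(P)-2)$ if $P$ is type II and not fixed by $\psi$; and $0$ if $P$ is of type I, III or IV. *)

(* Defs.v *)
From HB Require Import structures.
From mathcomp Require Import all_boot all_order all_algebra finmap.
From mathcomp Require Import all_classical all_reals all_analysis.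

Set Implicit Arguments.
Unset Strict Implicit.
Unset Printing Implicit Defensive.

Import Order.TTheory GRing.Theory Num.Theory.
Import numFieldNormedType.Exports.

Local Open Scope classical_set_scope.
Local Open Scope ring_scope.

Definition has_char (F : nzRingType) (p : nat) : Prop :=
  if p is 0 then [pchar F] =i pred0 else p \in [pchar F].

Notation ratfun F := {fraction {poly F}}.
Notation tofrac := (@FracField.tofrac _).

Section RationalFunctions.
Variable F : fieldType.

(* [repr] gives some fraction representing phi; dividing by the gcd puts it in
   lowest terms. *)
Definition rnum (phi : ratfun F) : {poly F} :=
  (repr phi).1 %/ gcdp (repr phi).1 (repr phi).2.
Definition rden (phi : ratfun F) : {poly F} :=
  (repr phi).2 %/ gcdp (repr phi).1 (repr phi).2.

Definition ratdeg (phi : ratfun F) : nat := (maxn (size (rnum phi)) (size (rden phi))).-1.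

Definition poly_at (h : {poly F}) (psi : ratfun F) : ratfun F :=
  (map_poly (tofrac \o polyC) h).[psi].

(* phi o psi, for psi not a constant equal to a pole of phi *)
Definition ratcomp (phi psi : ratfun F) : ratfun F :=
  poly_at (rnum phi) psi / poly_at (rden phi) psi.

Definition ratiter (phi : ratfun F) (n : nat) : ratfun F :=
  iter n (ratcomp phi) (tofrac 'X).

Definition mobius (M : 'M[F]_2) : ratfun F :=
  tofrac (M 0 0 *: 'X + (M 0 1)%:P) / tofrac (M 1 0 *: 'X + (M 1 1)%:P).

Definition ratconj (psi : ratfun F) (M : 'M[F]_2) : ratfun F :=
  ratcomp (mobius (invmx M)) (ratcomp psi (mobius M)).

(* The projective line over F: [Some a] is [a : 1] and [None] is [1 : 0]. *)
Definition P1 : Type := option F.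

Definition hcoord (x : P1) : F * F := if x is Some a then (a, 1) else (1, 0).

(* At infinity one compares the coefficients of degree d = deg phi. *)
Definition rat_eval (phi : ratfun F) (x : P1) : P1 :=
  let d := ratdeg phi in
  let: (a, b) := if x is Some z then ((rnum phi).[z], (rden phi).[z])
                 else ((rnum phi)`_d, (rden phi)`_d) in
  if b == 0 then None else Some (a / b).

Lemma rden_neq0 phi : rden phi != 0.
Proof.
rewrite /rden dvdp_div_eq0 ?dvdp_gcdr //; exact: denom_ratioP.
Qed.

Lemma rnum_rden phi : phi = tofrac (rnum phi) / tofrac (rden phi).
Proof.
set n := (repr phi).1; set d := (repr phi).2.
have dn0 : d != 0 by exact: denom_ratioP.
have phiE : phi * tofrac d = tofrac n.
  rewrite -[phi in LHS]reprK; unlock FracField.tofrac.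
  rewrite -[LHS]FracField.pi_mul; apply/eqmodP => /=.
  rewrite FracField.equivfE /FracField.mulf /=.
  by rewrite !numden_Ratio ?oner_neq0 ?mulr1 ?mulf_neq0 // -/d -/n mulrC.
have gn0 : gcdp n d != 0 by rewrite gcdp_eq0 negb_and dn0 orbT.
have tn0 (f : {poly F}) : f != 0 -> tofrac f != 0 by rewrite tofrac_eq0.
apply: (mulIf (tn0 _ (rden_neq0 phi))); rewrite divfK ?tn0 ?rden_neq0 //.
apply: (mulIf (tn0 _ gn0)); rewrite -mulrA -!rmorphM /=.
by rewrite /rnum /rden !divpK ?dvdp_gcdl ?dvdp_gcdr.
Qed.

Lemma coprimep_rnum_rden phi : coprimep (rnum phi) (rden phi).
Proof.
by apply: coprimep_div_gcd; rewrite orbC denom_ratioP.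
Qed.

Lemma rden_dvd phi (f g : {poly F}) :
  g != 0 -> phi = tofrac f / tofrac g -> rnum phi * g = f * rden phi /\ rden phi %| g.
Proof.
move=> g0 phiE.
have tn0 (h : {poly F}) : h != 0 -> tofrac h != 0 by rewrite tofrac_eq0.
have E : rnum phi * g = f * rden phi.
  apply/eqP; rewrite -tofrac_eq !rmorphM /=.
  rewrite -eqr_div ?tn0 ?rden_neq0 //; apply/eqP.
  by rewrite -rnum_rden phiE.
split=> //; rewrite -(@Gauss_dvdpr _ _ (rnum phi)).
  by rewrite E dvdp_mull.
by rewrite coprimep_sym coprimep_rnum_rden.
Qed.

End RationalFunctions.

(* A non-Archimedean absolute value on K; nontriviality and completeness are
   the separate predicates below. *)
Record absval (K : fieldType) (R : realType) := AbsVal {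
  aval :> K -> R;
  aval_ge0 : forall x, 0 <= aval x;
  aval_eq0 : forall x, (aval x == 0) = (x == 0);
  avalM : forall x y, aval (x * y) = aval x * aval y;
  aval_ultra : forall x y, aval (x + y) <= Num.max (aval x) (aval y) }.

Definition av_nontrivial (K : fieldType) (R : realType) (v : absval K R) : Prop :=
  exists2 x : K, x != 0 & v x != 1.

Definition av_complete (K : fieldType) (R : realType) (v : absval K R) : Prop :=
  forall u : nat -> K,
    (forall e : R, 0 < e -> exists N : nat,
      forall m n : nat, (N <= m)%N -> (N <= n)%N -> v (u m - u n) < e) ->
    exists l : K, (fun n => v (u n - l)) @ \oo --> (0 : R).

(* The residue field of v: a field k with a surjective ring morphism from the
   ring of integers {v <= 1} to k with kernel {v < 1}.  The values of [red]
   outside the ring of integers are irrelevant. *)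
Record residue_map (K : fieldType) (R : realType) (v : absval K R)
    (k : fieldType) := ResidueMap {
  red :> K -> k;
  red1 : red 1 = 1;
  redD : forall x y, v x <= 1 -> v y <= 1 -> red (x + y) = red x + red y;
  redM : forall x y, v x <= 1 -> v y <= 1 -> red (x * y) = red x * red y;
  red_eq0 : forall x, v x <= 1 -> (red x == 0) = (v x < 1);
  red_surj : forall a : k, exists2 x, v x <= 1 & red x = a }.

Section Chordal.
Variables (K : fieldType) (R : realType) (v : absval K R).

Definition chordal (x y : P1 K) : R :=
  let: (x1, x2) := hcoord x in let: (y1, y2) := hcoord y in
  v (x1 * y2 - x2 * y1) / (Num.max (v x1) (v x2) * Num.max (v y1) (v y2)).

Definition lipschitz_const (phi : ratfun K) : \bar R :=
  ereal_sup [set l | exists x y : P1 K, x <> y /\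
    l = (chordal (rat_eval phi x) (rat_eval phi y) / chordal x y)%:E].

End Chordal.

Section Berkovich.
Variables (K : fieldType) (R : realType) (v : absval K R).

Definition mult_seminorm (s : {ptws {poly K} -> R}) : Prop :=
  [/\ forall f, 0 <= s f,
      forall c, s c%:P = v c,
      forall f g, s (f * g) = s f * s g &
      forall f g, s (f + g) <= s f + s g].

(* The Berkovich affine line, with the weakest topology making all the
   evaluations s |-> s f continuous. *)
Definition berkA1 : Type := set_type [set s | mult_seminorm s].
HB.instance Definition _ := Topological.on berkA1.

Definition berkP1 : Type := one_point_compactification berkA1.
HB.instance Definition _ := Pointed.on berkP1.
HB.instance Definition _ := Topological.on berkP1.

Definition berk_infty : berkP1 := None.

Definition seminorm_of (s : berkA1) : {poly K} -> R := val s.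

Definition berk_pt (s : {poly K} -> R) (hs : mult_seminorm s) : berkP1 :=
  Some (exist _ s (mem_set hs)).

Lemma seminorm_ofP (s : berkA1) : mult_seminorm (seminorm_of s).
Proof. exact: set_mem (valP s). Qed.

Lemma aval1 : v 1 = 1.
Proof.
have v1 : v 1 != 0 by rewrite aval_eq0 oner_neq0.
by apply: (mulfI v1); rewrite -avalM !mulr1.
Qed.

Lemma avalD x y : v (x + y) <= v x + v y.
Proof.
apply: (le_trans (aval_ultra v x y)).
by rewrite ge_max lerDl lerDr !aval_ge0.
Qed.

Lemma eval_seminorm (a : K) : mult_seminorm (fun f => v f.[a]).
Proof.
split=> [f|c|f g|f g]; rewrite ?hornerE ?aval_ge0 ?avalM //; exact: avalD.
Qed.

Definition typeI (x : P1 K) : berkP1 :=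
  if x is Some a then berk_pt (eval_seminorm a) else berk_infty.

Section Pushforward.
Variable s : berkA1.
Let N := seminorm_of s.

(* the extension of the seminorm to the rational functions regular at s *)
Definition seminorm_rat (psi : ratfun K) : R := N (rnum psi) / N (rden psi).

Let NC c : N c%:P = v c. Proof. by case: (seminorm_ofP s). Qed.
Let NM f g : N (f * g) = N f * N g. Proof. by case: (seminorm_ofP s). Qed.
Let ND f g : N (f + g) <= N f + N g. Proof. by case: (seminorm_ofP s). Qed.
Let N_ge0 f : 0 <= N f. Proof. by case: (seminorm_ofP s). Qed.
Let N1 : N 1 = 1. Proof. by rewrite -[1]/(1%:P) NC aval1. Qed.
Let N_neq0 f : N f != 0 -> f != 0.
Proof.
apply: contra_neq => ->; rewrite -[0]/((0 : K)%:P) NC.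
by apply/eqP; rewrite aval_eq0.
Qed.

Let tofrac_neq0 (h : {poly K}) : h != 0 -> tofrac h != 0.
Proof. by rewrite tofrac_eq0. Qed.

Let seminorm_rat_frac (psi : ratfun K) f g :
  N g != 0 -> psi = tofrac f / tofrac g ->
  N (rden psi) != 0 /\ seminorm_rat psi = N f / N g.
Proof.
move=> Ng psiE; have [E /dvdpP[h gE]] := rden_dvd (N_neq0 Ng) psiE.
have Nd : N (rden psi) != 0.
  by move: Ng; rewrite gE NM mulf_eq0 negb_or => /andP[].
by split=> //; apply/eqP; rewrite eqr_div // -!NM E.
Qed.

Let seminorm_ratM psi1 psi2 :
  N (rden psi1) != 0 -> N (rden psi2) != 0 ->
  N (rden (psi1 * psi2)) != 0 /\
  seminorm_rat (psi1 * psi2) = seminorm_rat psi1 * seminorm_rat psi2.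
Proof.
move=> d1 d2; have d12 : N (rden psi1 * rden psi2) != 0 by rewrite NM mulf_neq0.
have [|-> ->] := @seminorm_rat_frac (psi1 * psi2) (rnum psi1 * rnum psi2) _ d12.
  by rewrite {1}(rnum_rden psi1) {1}(rnum_rden psi2) !rmorphM /= mulf_div.
by rewrite !NM -mulf_div.
Qed.

Let seminorm_ratD psi1 psi2 :
  N (rden psi1) != 0 -> N (rden psi2) != 0 ->
  N (rden (psi1 + psi2)) != 0 /\
  seminorm_rat (psi1 + psi2) <= seminorm_rat psi1 + seminorm_rat psi2.
Proof.
move=> d1 d2; have d12 : N (rden psi1 * rden psi2) != 0 by rewrite NM mulf_neq0.
have [|-> ->] := @seminorm_rat_frac (psi1 + psi2)
    (rnum psi1 * rden psi2 + rnum psi2 * rden psi1) _ d12.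
  rewrite {1}(rnum_rden psi1) {1}(rnum_rden psi2) addf_div ?tofrac_neq0 ?rden_neq0 //.
  by rewrite rmorphD !rmorphM.
split=> //; rewrite /seminorm_rat addf_div // -!NM ler_wpM2r ?invr_ge0 //.
Qed.

Let seminorm_rat_const c :
  N (rden (tofrac c%:P)) != 0 /\ seminorm_rat (tofrac c%:P) = v c.
Proof.
have N1' : N 1 != 0 by rewrite N1 oner_neq0.
have [|-> ->] := @seminorm_rat_frac (tofrac c%:P) c%:P 1 N1'.
  by rewrite rmorph1 divr1.
by rewrite N1 divr1 NC.
Qed.

Let poly_at_regular (phi : ratfun K) : N (rden phi) != 0 ->
  forall h, N (rden (poly_at h phi)) != 0.
Proof.
move=> d; elim/poly_ind => [|h c IH].
  rewrite /poly_at rmorph0 horner0.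
  rewrite -[0]/(tofrac (0 : K)%:P) ?polyC0.
  by have [] := seminorm_rat_const 0.
rewrite /poly_at rmorphD rmorphM /= map_polyX map_polyC /= hornerD hornerMX hornerC.
have [d1 _] := seminorm_ratM IH d.
by have [] := seminorm_ratD d1 (seminorm_rat_const c).1.
Qed.

Lemma pushforward_seminorm (phi : ratfun K) : seminorm_of s (rden phi) != 0 ->
  mult_seminorm (fun h => seminorm_rat (poly_at h phi)).
Proof.
move=> /poly_at_regular reg; split=> [f|c|f g|f g].
- by rewrite divr_ge0.
- by rewrite /poly_at map_polyC hornerC; have [] := seminorm_rat_const c.
- rewrite {1}/poly_at rmorphM hornerM.
  by have [] := seminorm_ratM (reg f) (reg g).
- rewrite {1}/poly_at rmorphD hornerD.
  by have [] := seminorm_ratD (reg f) (reg g).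
Qed.

End Pushforward.

(* phi(x) is the seminorm h |-> [h o phi]_x, or infinity when x is a pole. *)
Definition berk_act (phi : ratfun K) (x : berkP1) : berkP1 :=
  match x with
  | Some s => if @idP (seminorm_of s (rden phi) != 0) is ReflectT reg
              then berk_pt (pushforward_seminorm reg) else berk_infty
  | None => typeI (rat_eval phi None)
  end.

Definition disc (a : K) (r : R) : set K := [set z | v (z - a) <= r].

Definition disc_norm (a : K) (r : R) (f : {poly K}) : R :=
  sup [set v f.[z] | z in disc a r].

(* [disc_norm a r] is multiplicative for r > 0 by Gauss's lemma, so the value
   infinity is never taken for K algebraically closed and nontrivially valued *)
Definition zeta (a : K) (r : R) : berkP1 :=
  xget berk_infty (Some @` [set s : berkA1 | seminorm_of s = disc_norm a r]).

Definition zetaG : berkP1 := zeta 0 1.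

Definition is_typeI (x : berkP1) : Prop := exists a, x = typeI a.

Definition is_typeII (x : berkP1) : Prop :=
  exists (a c : K), c != 0 /\ x = zeta a (v c).

Definition berkH1 : set berkP1 := [set x | ~ is_typeI x].

(* the component of P^1 \ {P} containing x *)
Definition component_at (P x : berkP1) : set berkP1 :=
  connected_component (~` [set P]) x.

(* A tangent direction at P is identified with the corresponding component
   of P^1 \ {P}. *)
Definition tangents (P : berkP1) : set (set berkP1) :=
  [set B | exists2 x, x <> P & B = component_at P x].

(* the path [x, y]: the (unique) arc from x to y, or {x} when x = y *)
Definition berk_path (x y : berkP1) : set berkP1 :=
  [set z | (x = y /\ z = x) \/
    exists g : R -> berkP1,
      [/\ {within `[0, 1], continuous g}, {in `[0, 1] &, injective g},
          g 0 = x, g 1 = y & exists2 t, t \in `[0, 1] & g t = z]].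

Definition berk_wedge (x y : berkP1) : berkP1 :=
  xget x (berk_path x y `&` berk_path x zetaG `&` berk_path y zetaG).

(* A point of the closed disc D(0, 1) not of type I is the limit of the points
   zeta_(a_n, r_n) of a nested sequence of discs in D(0, 1), and its diameter
   is the limit of the r_n; for x = zeta_(a, r) this is r. *)
Definition diam_disc (x : berkP1) : R :=
  xget 0 [set d : R | exists (a : nat -> K) (r : nat -> R),
    [/\ forall n, 0 < r n /\ disc (a n) (r n) `<=` disc 0 1,
        forall n, disc (a n.+1) (r n.+1) `<=` disc (a n) (r n),
        (fun n => zeta (a n) (r n)) @ \oo --> x & r @ \oo --> d]].

Definition diam (x : berkP1) : R :=
  if x \in component_at zetaG berk_infty
  then diam_disc (berk_act (tofrac 'X)^-1 x) else diam_disc x.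

Definition logb (q x : R) : R := ln x / ln q.

Definition rho (q : R) (x y : berkP1) : R :=
  2 * logb q (diam (berk_wedge x y)) - logb q (diam x) - logb q (diam y).

Definition rat_fixed (psi : ratfun K) : set (P1 K) := [set a | rat_eval psi a = a].

Definition gamma_fix (psi : ratfun K) : set berkP1 :=
  [set z | exists a b, [/\ rat_fixed psi a, rat_fixed psi b &
                           berk_path (typeI a) (typeI b) z]].

(* The valence counts the tangent directions at P along which Gamma_Fix leaves
   P; [fset_set] is meant for finite sets, and this one is finite. *)
Definition valence_fix (psi : ratfun K) (P : berkP1) : nat :=
  if P \in gamma_fix psi
  then #|` fset_set (tangents P `&` [set B | B `&` gamma_fix psi !=set0])|
  else 0%N.

Section Weights.
Variables (k : fieldType) (red : residue_map v k).

Definition red_poly (f : {poly K}) : {poly k} := map_poly red f.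

Definition reduction (psi : ratfun K) : ratfun k :=
  xget 0 [set tau | exists f g : {poly K},
    [/\ coprimep f g, psi = tofrac f / tofrac g,
        forall i, v f`_i <= 1 /\ v g`_i <= 1,
        exists i, v f`_i = 1 \/ v g`_i = 1 &
        tau = tofrac (red_poly f) / tofrac (red_poly g)]].

Definition red_P1 (x : P1 K) : P1 k :=
  if x is Some a then (if v a <= 1 then Some (red a) else None) else None.

(* some gamma in GL_2(K) with gamma(zeta_G) = P, for P of type II *)
Definition chart (P : berkP1) : 'M[K]_2 :=
  xget 1%:M [set M | M \in unitmx /\ berk_act (mobius M) zetaG = P].

Definition reduction_at (psi : ratfun K) (P : berkP1) : ratfun k :=
  reduction (ratconj psi (chart P)).

Definition deg_at (psi : ratfun K) (P : berkP1) : nat := ratdeg (reduction_at psi P).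

(* The direction B at P corresponds to alpha under T_P = P^1(k): it contains
   gamma(a) for a point a of P^1(K) reducing to alpha. *)
Definition dir_coord (P : berkP1) (B : set berkP1) (alpha : P1 k) : Prop :=
  exists2 a : P1 K, red_P1 a = alpha & B (typeI (rat_eval (mobius (chart P)) a)).

(* the graph of psi_* : T_P -> T_P *)
Definition tangent_map (psi : ratfun K) (P : berkP1) (B C : set berkP1) : Prop :=
  [/\ tangents P B, tangents P C &
      exists2 alpha, dir_coord P B alpha &
        dir_coord P C (rat_eval (reduction_at psi P) alpha)].

Definition shearing (psi : ratfun K) (P : berkP1) : set (set berkP1) :=
  [set B | [/\ tangents P B, exists2 a, rat_fixed psi a & B (typeI a) &
               ~ tangent_map psi P B B]].

Definition weight (psi : ratfun K) (P : berkP1) : nat :=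
  if `[< is_typeII P >] then
    if berk_act psi P == P
    then (deg_at psi P - 1 + #|` fset_set (shearing psi P)|)%N
    else (valence_fix psi P - 2)%N
  else 0%N.

End Weights.

End Berkovich.

Arguments zetaG {K R} v.

(* Main.v *)
Require Import Defs.
From mathcomp Require Import all_boot all_order all_algebra finmap.
From mathcomp Require Import all_classical all_reals all_analysis.
From mathcomp Require Import ring lra zify.

Import Order.TTheory GRing.Theory Num.Theory.
Import numFieldNormedType.Exports.
Local Open Scope classical_set_scope.
Local Open Scope ring_scope.

Set Implicit Arguments.
Unset Strict Implicit.
Unset Printing Implicit Defensive.

(** Put M = Lt^n and psi = phi^n.  Then psi expands chordal distances by a factor
at most M, and the theorem follows from a statement about one map: a type II point
P with diam P < M^-2 has weight 0 for psi.  A point of positive weight then satisfies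
rho(P, zeta_G) <= 2 log M = 2 n log Lt < 3 n log Lt, for every n > 0.

Write P as the image k(zeta_{0,|c|}) with k in GL_2 over the ring of integers and
|c| = diam P.  Such a k is a chordal isometry, so F/G = k^-1 psi k has the same
Lipschitz bound.  Suppose that |c| < M^-2 and that F/G maps some point of D(0,|c|)
into the open unit disc; in both cases below this is so ([fixed_zetaG_small_value],
[fixed_point_small_value]).  The open disc of radius 1/M about 0 then has an image of
chordal diameter less than 1, which stays in the open unit disc
([small_value_spreads]).  Hence G has no zero there, can be normalized by G(0) = 1,
and the Cauchy estimates on a radius s with |c| < s^2 < M^-2 show that the rescaled
map h(z) = c^-1 F(cz)/G(cz) has the form (f0 + f1 z + small)/(1 + small), where all
the small coefficients have absolute value less than 1 ([local_form]).

If psi fixes P, then h fixes zeta_G.  This forces |f0| <= 1 and |f1| = 1, so that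
the reduction of h is the affine map f1 z + f0 ([fixed_zetaG_coef]).  It has degree
1, and a fixed point of h reduces to a fixed point of the reduction: nothing shears,
and both terms of the weight vanish.

If psi does not fix P but P has valence at least 3 in Gamma_Fix, then three type I
fixed points of psi lie in distinct directions at P, that is, h has three fixed
points with distinct reductions.  Two of the reductions are finite, and subtracting
the equations f0 + (f1 - 1) y = small at the two points gives |f1 - 1| < 1 and
|f0| <= 1 ([two_fixed_points_coef]).  Then h fixes zeta_G ([coef_fixed_zetaG]),
that is, psi fixes P: a contradiction.

The rest translates between the Berkovich line and such computations.  A type II
point is a norm on the polynomials, it is determined by its values on the X - e, and
rational functions act functorially on norms ([berk_act_comp]).  A chart at P is
determined up to the stabilizer of zeta_G, which is GL_2 of the ring of integers up
to scalars ([zetaG_stabilizer]); it follows that the reduction at P changes by a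
conjugation ([reduction_conj]) and that points with equal reductions in a chart lie
in one direction ([component_chart]), where they are joined by the continuous paths
t |-> zeta_{a,t}. *)

(** * Lifts of rational functions to pairs of forms *)

(** The value at (x, y) of the form of degree D that dehomogenizes to F.  Points at infinity
and poles then need no separate treatment. *)
Definition heval (A : comNzRingType) (D : nat) (F : {poly A}) (x y : A) : A :=
  \sum_(i < D.+1) F`_i * x ^+ i * y ^+ (D - i).

Lemma hevalZ (A : comNzRingType) D (F : {poly A}) c x y :
  heval D (c *: F) x y = c * heval D F x y.
Proof. by rewrite mulr_sumr; apply: eq_bigr => i _; rewrite coefZ !mulrA. Qed.

Lemma hevalD (A : comNzRingType) D (F G : {poly A}) x y :
  heval D (F + G) x y = heval D F x y + heval D G x y.
Proof. by rewrite -big_split; apply: eq_bigr => i _; rewrite coefD !mulrDl. Qed.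

Lemma heval_sum (A : comNzRingType) D I (r : seq I) (F : I -> {poly A}) x y :
  heval D (\sum_(i <- r) F i) x y = \sum_(i <- r) heval D (F i) x y.
Proof.
elim/big_rec2: _ => [|i a b _ <-]; last by rewrite hevalD.
by apply: big1 => i _; rewrite coef0 !mul0r.
Qed.

Lemma heval_scale (A : comNzRingType) D (F : {poly A}) c x y :
  heval D F (c * x) (c * y) = c ^+ D * heval D F x y.
Proof.
rewrite mulr_sumr; apply: eq_bigr => i _.
rewrite !exprMn -[in c ^+ D](subnKC (_ : i <= D)%N) ?exprD; last by rewrite -ltnS.
by ring.
Qed.

Lemma heval_y0 (A : comNzRingType) D (F : {poly A}) x : heval D F x 0 = F`_D * x ^+ D.
Proof.
rewrite /heval big_ord_recr /= subnn mulr1 big1 ?add0r // => i _.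
by rewrite expr0n subn_eq0 leqNgt ltn_ord mulr0.
Qed.

Lemma heval_y1 (A : comNzRingType) D (F : {poly A}) x :
  (size F <= D.+1)%N -> heval D F x 1 = F.[x].
Proof.
move=> sF; rewrite (horner_coef_wide _ sF).
by apply: eq_bigr => i _; rewrite expr1n mulr1.
Qed.

Lemma heval_horner (A : fieldType) D (F : {poly A}) x y :
  (size F <= D.+1)%N -> y != 0 -> heval D F x y = y ^+ D * F.[x / y].
Proof.
by move=> sF y0; rewrite -(heval_y1 _ sF) -heval_scale mulr1 mulrC divfK.
Qed.

(** On the line y = 0 this compares the coefficients of top degree, elsewhere it is
dehomogenization. *)
Lemma hevalM (A : fieldType) m n (F G : {poly A}) x y :
  (size F <= m.+1)%N -> (size G <= n.+1)%N ->
  heval (m + n) (F * G) x y = heval m F x y * heval n G x y.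
Proof.
move=> sF sG.
have sFG : (size (F * G)%R <= (m + n).+1)%N.
  by apply: leq_trans (size_polyMleq _ _) _; lia.
have [->|y0] := eqVneq y 0; last by rewrite !heval_horner // hornerM exprD; ring.
rewrite !heval_y0 exprD; suff -> : (F * G)`_(m + n) = F`_m * G`_n by ring.
have lm : (m < (m + n).+1)%N by lia.
rewrite coefM (bigD1 (Ordinal lm)) //= addKn big1 ?addr0 // => i.
rewrite -val_eqE /= neq_ltn => /orP[im|im].
  by rewrite [G`__]nth_default ?mulr0 //; apply: leq_trans sG _; rewrite /= in im; lia.
by rewrite [F`_i]nth_default ?mul0r //; apply: leq_trans sF _.
Qed.

Lemma size_exp_wide (A : fieldType) m k (F : {poly A}) :
  (size F <= m.+1)%N -> (size (F ^+ k)%R <= (m * k).+1)%N.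
Proof.
move=> sF; elim: k => [|k IH]; first by rewrite expr0 size_poly1.
by rewrite exprS; apply: leq_trans (size_polyMleq _ _) _; lia.
Qed.

Lemma hevalX (A : fieldType) m k (F : {poly A}) x y : (size F <= m.+1)%N ->
  heval (m * k) (F ^+ k) x y = heval m F x y ^+ k.
Proof.
move=> sF; have sk j := size_exp_wide j sF.
elim: k => [|k IH]; first by rewrite muln0 /heval big_ord1 !expr0 coef1 !mulr1.
by rewrite !exprS mulnS hevalM // IH.
Qed.

(** Substitution of the pair (U, V) into the form of degree D attached to F. *)
Definition hcomp (A : comNzRingType) D (F U V : {poly A}) : {poly A} :=
  heval D (map_poly polyC F) U V.

Lemma hcompE (A : comNzRingType) D (F U V : {poly A}) :
  hcomp D F U V = \sum_(i < D.+1) F`_i *: (U ^+ i * V ^+ (D - i)).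
Proof.
by apply: eq_bigr => i _; rewrite coef_map /= -mulrA mul_polyC.
Qed.

Lemma horner_hcomp (A : comNzRingType) D (F U V : {poly A}) x :
  (hcomp D F U V).[x] = heval D F U.[x] V.[x].
Proof.
rewrite hcompE horner_sum; apply: eq_bigr => i _.
by rewrite hornerZ hornerM !horner_exp mulrA.
Qed.

Lemma size_hcomp (A : fieldType) m n (F U V : {poly A}) :
  (size U <= n.+1)%N -> (size V <= n.+1)%N -> (size (hcomp m F U V) <= (m * n).+1)%N.
Proof.
move=> sU sV; rewrite hcompE; apply: leq_trans (size_sum _ _ _) _.
apply/bigmax_leqP => i _; apply: leq_trans (size_scale_leq _ _) _.
apply: leq_trans (size_polyMleq _ _) _.
suff H a b : (a <= (n * i).+1)%N -> (b <= (n * (m - i)).+1)%N -> ((a + b).-1 <= (m * n).+1)%N.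
  by apply: H; apply: size_exp_wide.
have : (n * i <= n * m)%N by rewrite leq_mul2l -ltnS ltn_ord orbT.
by rewrite mulnBr [(m * n)%N]mulnC; lia.
Qed.

Lemma heval_hcomp (A : fieldType) m n (F U V : {poly A}) x y :
  (size U <= n.+1)%N -> (size V <= n.+1)%N ->
  heval (m * n) (hcomp m F U V) x y = heval m F (heval n U x y) (heval n V x y).
Proof.
move=> sU sV; rewrite hcompE heval_sum; apply: eq_bigr => i _; rewrite hevalZ -mulrA; congr (_ * _).
rewrite -!hevalX // -hevalM ?size_exp_wide //; congr heval.
by rewrite -mulnDr subnKC 1?mulnC // -ltnS.
Qed.

Section Lifts.
Variable F : fieldType.
Implicit Types (phi psi : ratfun F) (f g : {poly F}) (x y : F).

Definition toP1 x y : P1 F := if y == 0 then None else Some (x / y).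

(** The pair (f, g) represents phi in homogeneous coordinates in degree D: coprimality
excludes a common zero in the affine part, and the condition on the coefficients of
degree D a common zero at infinity. *)
Definition is_lift D f g phi :=
  [/\ [/\ (size f <= D.+1)%N, (size g <= D.+1)%N & (f`_D != 0) || (g`_D != 0)],
      coprimep f g, g != 0 & phi = tofrac f / tofrac g].

Lemma hcoordK (x : P1 F) : toP1 (hcoord x).1 (hcoord x).2 = x.
Proof. by case: x => [a|]; rewrite /toP1 /= ?oner_eq0 ?eqxx // divr1. Qed.

Lemma hcoord_neq0 (x : P1 F) : ((hcoord x).1 != 0) || ((hcoord x).2 != 0).
Proof. by case: x => [a|] /=; rewrite oner_neq0 ?orbT. Qed.

Lemma toP1_scale c x y : c != 0 -> toP1 (c * x) (c * y) = toP1 x y.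
Proof.
move=> c0; rewrite /toP1 mulf_eq0 (negPf c0) /=; case: eqP => // /eqP y0.
by congr Some; rewrite -mulf_div divff // mul1r.
Qed.

Lemma toP1_hcoord x y : (x != 0) || (y != 0) ->
  exists2 c, c != 0 & x = c * (hcoord (toP1 x y)).1 /\ y = c * (hcoord (toP1 x y)).2.
Proof.
rewrite /toP1; have [->|y0] := eqVneq y 0.
  by rewrite /= orbF => x0; exists x; rewrite // mulr1 mulr0.
by move=> _; exists y => //; rewrite mulr1 mulrC divfK.
Qed.

Lemma toP1_eq x y x' y' : (x != 0) || (y != 0) -> (x' != 0) || (y' != 0) ->
  x * y' = x' * y -> toP1 x y = toP1 x' y'.
Proof.
rewrite /toP1; have [->|y0] := eqVneq y 0; have [->|y'0] := eqVneq y' 0 => //=;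
  rewrite ?eqxx ?orbT ?orbF => x0 x'0 E.
- by move/eqP: E; rewrite mulr0 mulf_eq0 (negPf x0) (negPf y'0).
- by move/eqP: E; rewrite mulr0 eq_sym mulf_eq0 (negPf x'0) (negPf y0).
- by congr Some; apply/eqP; rewrite eqr_div // E.
Qed.

Lemma lift_rnum phi : is_lift (ratdeg phi) (rnum phi) (rden phi) phi.
Proof.
have d0 := rden_neq0 phi; have sd : (0 < size (rden phi))%N by rewrite size_poly_gt0.
rewrite /ratdeg; split; rewrite ?coprimep_rnum_rden -?rnum_rden //; split.
- by rewrite prednK ?leq_maxl // leq_max sd orbT.
- by rewrite prednK ?leq_maxr // leq_max sd orbT.
- case: (leqP (size (rden phi)) (size (rnum phi))) => le.
    have n0 : rnum phi != 0 by rewrite -size_poly_gt0; apply: leq_trans le.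
    by rewrite -lead_coefE lead_coef_eq0 n0.
  by rewrite -lead_coefE lead_coef_eq0 d0 orbT.
Qed.

Lemma lift_deg D f g phi : is_lift D f g phi -> D = (maxn (size f) (size g)).-1.
Proof.
case=> [[sf sg top] _ _ _]; suff -> : maxn (size f) (size g) = D.+1 by [].
apply/eqP; rewrite eqn_leq geq_max sf sg /= leq_max.
by case/orP: top => H; apply/orP; [left|right];
  rewrite ltnNge; apply: contra H => H; rewrite nth_default.
Qed.

(** Cross-multiplying, each denominator divides the other by coprimality. *)
Lemma lowest_terms_uniq f g f' g' : g != 0 -> g' != 0 -> coprimep f g -> coprimep f' g' ->
  tofrac f / tofrac g = tofrac f' / tofrac g' ->
  exists2 u, u != 0 & f' = u *: f /\ g' = u *: g.
Proof.
move=> g0 g'0 cop cop' E.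
have X : f * g' = f' * g.
  by apply/eqP; rewrite -tofrac_eq !rmorphM /= -eqr_div ?tofrac_eq0 // E.
have d1 : g %| g'.
  by rewrite -(@Gauss_dvdpr _ _ f) ?X ?dvdp_mull // coprimep_sym.
have d2 : g' %| g.
  by rewrite -(@Gauss_dvdpr _ _ f') -?X ?dvdp_mull // coprimep_sym.
have /eqpP[[c1 c2] /= /andP[c10 c20] Ec] : g %= g' by rewrite /eqp d1 d2.
pose u := c1 / c2; have u0 : u != 0 by rewrite mulf_neq0 ?invr_eq0.
have gE : g' = u *: g.
  by apply: (scalerI c20); rewrite -Ec scalerA /u mulrCA divff ?mulr1.
exists u => //; split=> //.
by apply: (mulIf g0); rewrite -X gE -scalerAr -scalerAl.
Qed.

Lemma lift_uniq D f g D' f' g' phi :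
  is_lift D f g phi -> is_lift D' f' g' phi ->
  D' = D /\ exists2 u, u != 0 & f' = u *: f /\ g' = u *: g.
Proof.
move=> L L'; have [_ cop g0 E] := L; have [_ cop' g'0 E'] := L'.
have [|u u0 [fE gE]] := lowest_terms_uniq g0 g'0 cop cop'; first by rewrite -E.
split; last by exists u.
by rewrite (lift_deg L) (lift_deg L') fE gE !size_scale.
Qed.

Lemma lift_heval_neq0 D f g phi x y : is_lift D f g phi -> (x != 0) || (y != 0) ->
  (heval D f x y != 0) || (heval D g x y != 0).
Proof.
case=> [[sf sg top] cop _ _]; have [->|y0] := eqVneq y 0.
  rewrite /= orbF => x0; rewrite !heval_y0 !mulf_eq0 !negb_or !expf_neq0 //.
  by rewrite !andbT.
rewrite !heval_horner // !mulf_eq0 expf_eq0 (negPf y0) andbF /= => _.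
have [r0|//] := eqVneq f.[x / y] 0; apply/negP => s0.
by have := coprimep_root cop (introT eqP r0); rewrite s0.
Qed.

Lemma lift_ratdeg D f g phi : is_lift D f g phi -> ratdeg phi = D.
Proof. by move=> L; have [] := lift_uniq L (lift_rnum phi). Qed.

Lemma rat_evalE phi (z : P1 F) : rat_eval phi z =
  toP1 (if z is Some a then (rnum phi).[a] else (rnum phi)`_(ratdeg phi))
       (if z is Some a then (rden phi).[a] else (rden phi)`_(ratdeg phi)).
Proof. by case: z. Qed.

Lemma lift_eval D f g phi x y : is_lift D f g phi -> (x != 0) || (y != 0) ->
  rat_eval phi (toP1 x y) = toP1 (heval D f x y) (heval D g x y).
Proof.
move=> L xy; have [ED [u u0 [En Ed]]] := lift_uniq L (lift_rnum phi).
have [[sf sg _] _ _ _] := L.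
rewrite rat_evalE ED En Ed; have [y0|y0] := eqVneq y 0.
  rewrite y0 eqxx orbF in xy.
  have -> : toP1 x y = None by rewrite /toP1 y0 eqxx.
  by rewrite y0 !heval_y0 !coefZ ![_ * x ^+ D]mulrC !toP1_scale // expf_neq0.
have -> : toP1 x y = Some (x / y) by rewrite /toP1 (negPf y0).
by rewrite !hornerZ toP1_scale // !heval_horner // toP1_scale // expf_neq0.
Qed.

Lemma lift_eval_hcoord D f g phi (x : P1 F) : is_lift D f g phi ->
  rat_eval phi x = toP1 (heval D f (hcoord x).1 (hcoord x).2) (heval D g (hcoord x).1 (hcoord x).2).
Proof. by move=> L; rewrite -{1}[x]hcoordK (lift_eval L) ?hcoord_neq0. Qed.

Lemma det2 (M : 'M[F]_2) : \det M = M 0 0 * M 1 1 - M 0 1 * M 1 0.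
Proof.
rewrite (expand_det_row _ 0) !big_ord_recl big_ord0 addr0 /cofactor !det_mx11 !mxE /=.
rewrite expr0 mul1r expr1 mulN1r mulrN.
by congr (_ * M _ _ - M _ _ * M _ _); apply/val_inj.
Qed.

Definition lin (a b : F) : {poly F} := a *: 'X + b%:P.

Lemma size_lin a b : (size (lin a b) <= 2)%N.
Proof.
apply: leq_trans (size_polyD _ _) _; rewrite geq_max size_polyC.
apply/andP; split; last by case: eqP.
by apply: leq_trans (size_scale_leq _ _) _; rewrite size_polyX.
Qed.

Lemma coef_lin a b i : (lin a b)`_i = if i is 0 then b else if i is 1%N then a else 0.
Proof. by case: i => [|[|i]]; rewrite !(coefE, coefX) /= ?mulr0 ?mulr1 ?add0r ?addr0. Qed.

Lemma lin_eq0 a b : (lin a b == 0) = (a == 0) && (b == 0).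
Proof.
apply/eqP/andP => [E|[/eqP-> /eqP->]]; last by rewrite /lin scale0r add0r polyC0.
by split; [move: (coef_lin a b 1)|move: (coef_lin a b 0)]; rewrite E coef0 => <-.
Qed.

Lemma mobius_lift (M : 'M[F]_2) : M \in unitmx ->
  is_lift 1 (lin (M 0 0) (M 0 1)) (lin (M 1 0) (M 1 1)) (mobius M).
Proof.
rewrite unitmxE unitfE det2 => dM.
have c0 : (M 1 0 != 0) || (M 1 1 != 0).
  by rewrite -negb_and; apply: contra dM => /andP[/eqP-> /eqP->]; rewrite !mulr0 subr0.
split=> //; last by rewrite lin_eq0 negb_and.
  split; rewrite ?size_lin // !coef_lin -negb_and.
  by apply: contra dM => /andP[/eqP-> /eqP->]; rewrite mul0r mulr0 subr0.
apply/Bezout_eq1_coprimepP; set d := _ - _ in dM.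
have dP : (d^-1 * d)%:P = 1 :> {poly F} by rewrite mulVf.
exists (- (d^-1 * M 1 0)%:P, (d^-1 * M 0 0)%:P).
rewrite /= /lin -!mul_polyC -dP /d !(rmorphM, rmorphB) /=; ring.
Qed.

Lemma heval_lin a b x y : heval 1 (lin a b) x y = a * x + b * y.
Proof.
by rewrite /heval big_ord_recl big_ord1 !coef_lin /= !expr0 !expr1 !mulr1 addrC.
Qed.

Lemma mobius_eval (M : 'M[F]_2) x y : M \in unitmx -> (x != 0) || (y != 0) ->
  rat_eval (mobius M) (toP1 x y) = toP1 (M 0 0 * x + M 0 1 * y) (M 1 0 * x + M 1 1 * y).
Proof.
move=> M1 xy; rewrite (lift_eval (mobius_lift M1)) //.
by rewrite !heval_lin.
Qed.

Lemma mobius_coord_neq0 (M : 'M[F]_2) x y : M \in unitmx -> (x != 0) || (y != 0) ->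
  (M 0 0 * x + M 0 1 * y != 0) || (M 1 0 * x + M 1 1 * y != 0).
Proof.
by move=> M1 /(lift_heval_neq0 (mobius_lift M1)); rewrite !heval_lin.
Qed.

End Lifts.

(** * Composition of rational functions *)

Lemma expr_div_pad (L : fieldType) (a b : L) i D : (i <= D)%N -> b != 0 ->
  (a / b) ^+ i = a ^+ i * b ^+ (D - i) / b ^+ D.
Proof.
move=> iD b0; rewrite expr_div_n -[in b ^+ D](subnKC iD) exprD -mulf_div divff ?mulr1 //.
exact: expf_neq0.
Qed.

Section Composition.
Variable F : fieldType.
Implicit Types (phi psi : ratfun F) (f g p : {poly F}).

Lemma tofrac_neq0 f : (tofrac f != 0) = (f != 0).
Proof. by rewrite tofrac_eq0. Qed.

Lemma poly_atC c phi : poly_at c%:P phi = tofrac c%:P.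
Proof. by rewrite /poly_at map_polyC hornerC. Qed.

Lemma poly_atX phi : poly_at 'X phi = phi.
Proof. by rewrite /poly_at map_polyX hornerX. Qed.

Lemma poly_atD p1 p2 phi : poly_at (p1 + p2) phi = poly_at p1 phi + poly_at p2 phi.
Proof. by rewrite /poly_at rmorphD hornerD. Qed.

Lemma poly_atM p1 p2 phi : poly_at (p1 * p2) phi = poly_at p1 phi * poly_at p2 phi.
Proof. by rewrite /poly_at rmorphM hornerM. Qed.

Lemma poly_atZ c p phi : poly_at (c *: p) phi = tofrac c%:P * poly_at p phi.
Proof. by rewrite -mul_polyC poly_atM poly_atC. Qed.

Lemma poly_at_frac D p f g : g != 0 -> (size p <= D.+1)%N ->
  poly_at p (tofrac f / tofrac g) = tofrac (hcomp D p f g) / tofrac (g ^+ D).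
Proof.
move=> g0 sp; rewrite /poly_at (horner_coef_wide _ (leq_trans (size_poly _ _) sp)).
rewrite hcompE rmorph_sum mulr_suml; apply: eq_bigr => i _.
rewrite coef_map /= -mul_polyC !rmorphM !rmorphXn /= -mulrA; congr (_ * _).
have iD : (i <= D)%N by rewrite -ltnS.
have t0 : tofrac g != 0 by rewrite tofrac_neq0.
exact: expr_div_pad.
Qed.

Lemma rnum_eq0 phi : (rnum phi == 0) = (phi == 0).
Proof.
apply/eqP/eqP => [E|->]; first by rewrite [phi]rnum_rden E rmorph0 mul0r.
have /esym/eqP := rnum_rden (0 : ratfun F); rewrite mulf_eq0 invr_eq0 !tofrac_eq0.
by rewrite (negPf (rden_neq0 (0 : ratfun F))) orbF => /eqP.
Qed.

Lemma ratfun_divE phi psi :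
  phi / psi = tofrac (rnum phi * rden psi) / tofrac (rden phi * rnum psi).
Proof. by rewrite {1}(rnum_rden phi) {1}(rnum_rden psi) invf_div mulf_div -!rmorphM. Qed.

(** Composition on the right with phi is then defined on all rational functions.  The property
holds for all nonconstant phi over an algebraically closed field. *)
Record transcendental phi : Prop := Transcendental {
  poly_at_neq0 : forall p, p != 0 -> poly_at p phi != 0 }.

Lemma poly_at_tofracX p : poly_at p (tofrac 'X) = tofrac p.
Proof.
elim/poly_ind: p => [|p c IH]; first by rewrite -polyC0 poly_atC.
by rewrite poly_atD poly_atM poly_atX IH poly_atC rmorphD rmorphM.
Qed.

Lemma transc_tofracX : transcendental (tofrac 'X).
Proof. by split=> p; rewrite poly_at_tofracX tofrac_neq0. Qed.

Lemma ratcompE phi psi f g : transcendental psi -> g != 0 ->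
  phi = tofrac f / tofrac g -> ratcomp phi psi = poly_at f psi / poly_at g psi.
Proof.
move=> tr g0 /(rden_dvd g0)[E _]; rewrite /ratcomp; apply/eqP.
by rewrite eqr_div ?(poly_at_neq0 tr) ?rden_neq0 // -!poly_atM E.
Qed.

Lemma ratcomp_poly_at p phi psi : transcendental psi ->
  ratcomp (poly_at p phi) psi = poly_at p (ratcomp phi psi).
Proof.
move=> tr.
pose n := rnum phi; pose d := rden phi; have d0 : d != 0 := rden_neq0 phi.
have := @poly_at_frac (size p).-1 p n d d0 (leqSpred _).
rewrite -rnum_rden => /(ratcompE tr) -> ; last by rewrite expf_neq0.
rewrite /ratcomp -/n -/d.
have hP (q : {poly F}) k : poly_at (q ^+ k) psi = poly_at q psi ^+ k.
  by elim: k => [|k IH]; rewrite ?exprS ?poly_atM ?IH // !expr0 -[1]/(1%:P) poly_atC rmorph1.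
rewrite hP hcompE [in RHS]/poly_at.
rewrite (horner_coef_wide _ (leq_trans (size_poly _ _) (leqSpred _))).
rewrite (_ : poly_at (\sum_(i < _) _) psi = \sum_(i < (size p).-1.+1)
    poly_at (p`_i *: (n ^+ i * d ^+ ((size p).-1 - i))) psi); last first.
  elim/big_rec2: _ => [|i a b _ <-]; last by rewrite poly_atD.
  by rewrite -[0]/(0%:P) poly_atC rmorph0.
rewrite mulr_suml; apply: eq_bigr => i _.
have iD : (i <= (size p).-1)%N by rewrite -ltnS.
rewrite poly_atZ poly_atM !hP coef_map /= -mulrA; congr (_ * _).
by rewrite -!/(poly_at _ _) -expr_div_pad ?(poly_at_neq0 tr).
Qed.

Lemma ratcomp_frac phi1 phi2 psi : transcendental psi -> phi2 != 0 ->
  ratcomp (phi1 / phi2) psi = ratcomp phi1 psi / ratcomp phi2 psi.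
Proof.
move=> tr p20.
rewrite (ratcompE tr _ (ratfun_divE phi1 phi2)) ?mulf_neq0 ?rden_neq0 ?rnum_eq0 // !poly_atM.
by rewrite -mulf_div /ratcomp invf_div.
Qed.

Lemma ratcompA phi1 phi2 phi3 : transcendental phi2 -> transcendental phi3 ->
  ratcomp phi1 (ratcomp phi2 phi3) = ratcomp (ratcomp phi1 phi2) phi3.
Proof.
move=> t2 t3; rewrite [in RHS]/ratcomp -/(ratcomp _ _) ratcomp_frac ?(poly_at_neq0 t2) ?rden_neq0 //.
by rewrite !ratcomp_poly_at.
Qed.

Lemma mobiusE (M : 'M[F]_2) :
  mobius M = tofrac (lin (M 0 0) (M 0 1)) / tofrac (lin (M 1 0) (M 1 1)).
Proof. by []. Qed.

Lemma big_ord2 (V : nmodType) (h : 'I_2 -> V) : \sum_i h i = h 0 + h 1.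
Proof. by rewrite !big_ord_recl big_ord0 addr0; congr (_ + h _); apply/val_inj. Qed.

Lemma hcomp_lin (a b : F) (U V : {poly F}) : hcomp 1 (lin a b) U V = a *: U + b *: V.
Proof. by rewrite hcompE big_ord2 !coef_lin /= !expr0 !expr1 mul1r mulr1 addrC. Qed.

Lemma lin_comb (a b c d x y : F) :
  x *: lin a b + y *: lin c d = lin (x * a + y * c) (x * b + y * d).
Proof. by rewrite /lin !scalerDr !scalerA !scalerDl addrACA -!mul_polyC -!rmorphM -rmorphD. Qed.

End Composition.

Section ClosedLifts.
Variable K : closedFieldType.
Implicit Types (phi psi : ratfun K) (f g p : {poly K}).

Lemma poly_prod_ind (P : {poly K} -> Prop) :
  (forall c, c != 0 -> P c%:P) -> (forall z, P ('X - z%:P)) ->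
  (forall p q, P p -> P q -> P (p * q)) -> forall p, p != 0 -> P p.
Proof.
move=> PC PX PM p p0; have [r ->] := closed_field_poly_normal p.
rewrite -mul_polyC; apply: (PM); first by apply: (PC); rewrite lead_coef_eq0.
apply: (big_ind P) => //; exact: (PC 1 (oner_neq0 K)).
Qed.

Lemma coprimep_closed f g : (forall x, f.[x] != 0 \/ g.[x] != 0) -> coprimep f g.
Proof.
move=> H; rewrite /coprimep; apply/negPn/negP => /closed_rootP [x].
by rewrite root_gcd => /andP[/eqP fx /eqP gx]; case: (H x); rewrite ?fx ?gx eqxx.
Qed.

(** A polynomial splits into linear factors, so it is enough that phi is not a constant z;
otherwise f = z g would contradict coprimality in positive degree. *)
Lemma lift_transc D f g phi : (0 < D)%N -> is_lift D f g phi -> transcendental phi.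
Proof.
move=> D0 [[sf sg top] cop g0 E]; split; apply: poly_prod_ind => [c c0|z|p q P Q].
- by rewrite poly_atC tofrac_neq0 polyC_eq0.
- rewrite -polyCN poly_atD poly_atX poly_atC polyCN rmorphN subr_eq0 E.
  apply/eqP => H; have {H} fE : f = z *: g.
    apply/eqP; rewrite -tofrac_eq -mul_polyC rmorphM /= -H divfK ?tofrac_neq0 //.
  have : size g = 1%N.
    have /eqp_size-> : g %= 1 by move/coprimepP: cop; apply; rewrite // fE -mul_polyC dvdp_mull.
    exact: size_poly1.
  move=> sg1; have gD : g`_D = 0 by rewrite nth_default // sg1.
  by move: top; rewrite fE coefZ gD mulr0 eqxx.
- rewrite poly_atM; exact: mulf_neq0 P Q.
Qed.

(** Forms without common zeros compose to forms without common zeros. *)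
Lemma lift_comp D f g phi D' f' g' phi' : (0 < D')%N ->
  is_lift D f g phi -> is_lift D' f' g' phi' ->
  is_lift (D * D') (hcomp D f f' g') (hcomp D g f' g') (ratcomp phi phi').
Proof.
move=> D'0 L L'; have tr := lift_transc D'0 L'.
have [[sf sg top] cop g0 E] := L; have [[sf' sg' top'] cop' g'0 E'] := L'.
have pg0 : hcomp D g f' g' != 0.
  have := poly_at_neq0 tr g0; rewrite E' (poly_at_frac _ g'0 sg) => H.
  by apply: contra H => /eqP->; rewrite rmorph0 mul0r.
split=> //.
- split; rewrite ?size_hcomp //.
  have := lift_heval_neq0 (x := f'`_D') (y := g'`_D') L top'.
  have c1 (h : {poly K}) : h`_(D * D') = heval (D * D') h 1 0 by rewrite heval_y0 expr1n mulr1.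
  have c2 (h : {poly K}) : heval D' h 1 0 = h`_D' by rewrite heval_y0 expr1n mulr1.
  rewrite !c1 !heval_hcomp //.
  by rewrite !c2.
- apply: coprimep_closed => x; rewrite !horner_hcomp.
  have : (f'.[x] != 0) || (g'.[x] != 0).
    have [r0|//] := eqVneq f'.[x] 0.
    exact: coprimep_root cop' (introT eqP r0).
  by move/(lift_heval_neq0 L)/orP.
- rewrite (ratcompE tr g0 E) E' (poly_at_frac _ g'0 sf) (poly_at_frac _ g'0 sg).
  have t0 : tofrac (g' ^+ D) != 0 by rewrite tofrac_neq0 expf_neq0.
  by rewrite invf_div mulrA (divfK t0).
Qed.

Lemma rat_eval_comp D f g phi D' f' g' phi' x : (0 < D')%N ->
  is_lift D f g phi -> is_lift D' f' g' phi' ->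
  rat_eval (ratcomp phi phi') x = rat_eval phi (rat_eval phi' x).
Proof.
move=> D'0 L L'; have x0 := hcoord_neq0 x; have [[sf' sg' _] _ _ _] := L'.
rewrite (lift_eval_hcoord _ (lift_comp D'0 L L')) !heval_hcomp //.
by rewrite (lift_eval_hcoord _ L') (lift_eval L) // (lift_heval_neq0 L').
Qed.

Lemma mobius_transc (M : 'M[K]_2) : M \in unitmx -> transcendental (mobius M).
Proof. by move=> /mobius_lift; apply: lift_transc. Qed.

Lemma ratcomp_mobius (A B : 'M[K]_2) : A \in unitmx -> B \in unitmx ->
  ratcomp (mobius A) (mobius B) = mobius (A *m B).
Proof.
move=> A1 B1; have [_ _ g0 E] := lift_comp (ltn0Sn 0) (mobius_lift A1) (mobius_lift B1).
by rewrite E !hcomp_lin !lin_comb !mobiusE !mxE !big_ord2.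
Qed.

Lemma ratcomp1 phi : ratcomp phi (tofrac 'X) = phi.
Proof. by rewrite /ratcomp !poly_at_tofracX -rnum_rden. Qed.

Lemma mobius1 : mobius (1%:M : 'M[K]_2) = tofrac 'X.
Proof. by rewrite /mobius !mxE /= scale1r addr0 scale0r add0r rmorph1 divr1. Qed.

End ClosedLifts.

(** * The absolute value and sup-norms on discs *)

Lemma expr_unbounded (R : archiRealFieldType) (b c : R) : 1 < b -> exists n, c < b ^+ n.
Proof.
move=> b1; have bern n : 1 + n%:R * (b - 1) <= b ^+ n.
  elim: n => [|n IH]; first by rewrite mul0r addr0 expr0.
  rewrite exprS; apply: (@le_trans _ _ (b * (1 + n%:R * (b - 1)))); last first.
    by rewrite ler_pM2l // (lt_trans ltr01).
  have : 0 <= n%:R * (b - 1) ^+ 2 by rewrite mulr_ge0 ?sqr_ge0.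
  by rewrite -natr1; nra.
have d0 : 0 < b - 1 by rewrite subr_gt0.
exists (Num.bound `|c / (b - 1)|); apply: lt_le_trans (bern _).
have := archi_boundP (normr_ge0 (c / (b - 1))); set N := _%:R => cN.
rewrite -[c](divfK (lt0r_neq0 d0)); have := ler_norm (c / (b - 1)); nra.
Qed.

Lemma prod_max_continuous (R : realType) (I : Type) (c : R) (s : seq I) (h : I -> R) :
  continuous (fun t : R => c * \prod_(i <- s) Num.max t (h i)).
Proof.
move=> t; apply: cvgM; first exact: cvg_cst.
elim: s => [|w s IH].
  by under eq_fun do rewrite big_nil; rewrite big_nil; apply: cvg_cst.
under eq_fun do rewrite big_cons; rewrite big_cons; apply: cvgM IH.
by apply: (@continuous_max _ _ id (cst (h w))); [exact: cvg_id|exact: cvg_cst].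
Qed.

Section AbsoluteValue.
Variables (K : fieldType) (R : realType) (v : absval K R).

Lemma aval0 : v 0 = 0. Proof. by apply/eqP; rewrite aval_eq0. Qed.
Lemma aval_gt0 x : (0 < v x) = (x != 0).
Proof. by rewrite lt_neqAle aval_ge0 andbT eq_sym aval_eq0. Qed.
Lemma avalX x n : v (x ^+ n) = v x ^+ n.
Proof. by elim: n => [|n IH]; rewrite ?expr0 ?aval1 // !exprS avalM IH. Qed.
Lemma avalN x : v (- x) = v x.
Proof.
rewrite -mulN1r avalM; suff -> : v (-1) = 1 by rewrite mul1r.
have /eqP : v (-1) ^+ 2 = 1 by rewrite -avalX sqrrN expr1n aval1.
by rewrite sqrf_eq1 => /orP[/eqP//|/eqP E]; have := aval_ge0 v (-1); rewrite E oppr_ge0 ler10.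
Qed.
Lemma aval_subC x y : v (x - y) = v (y - x). Proof. by rewrite -avalN opprB. Qed.
Lemma avalV x : v x^-1 = (v x)^-1.
Proof.
have [->|x0] := eqVneq x 0; first by rewrite invr0 aval0 invr0.
have vx : v x != 0 by rewrite aval_eq0.
by apply: (mulfI vx); rewrite -avalM !divff ?aval1.
Qed.
Lemma aval_add_le x y b : v x <= b -> v y <= b -> v (x + y) <= b.
Proof. by move=> xb yb; apply: le_trans (aval_ultra v x y) _; rewrite ge_max xb. Qed.
Lemma aval_add_lt x y b : v x < b -> v y < b -> v (x + y) < b.
Proof. by move=> xb yb; apply: le_lt_trans (aval_ultra v x y) _; rewrite gt_max xb. Qed.
Lemma aval_add_dominant x y : v y < v x -> v (x + y) = v x.
Proof.
move=> yx; apply/le_anti; rewrite aval_add_le ?(ltW yx) //=.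
rewrite leNgt; apply/negP => H; suff : v x < v x by rewrite ltxx.
by rewrite -{1}(addrK y x) aval_add_lt ?avalN.
Qed.
Lemma aval_sum_le (I : Type) (r : seq I) (P : pred I) (f : I -> K) b : 0 <= b ->
  (forall i, P i -> v (f i) <= b) -> v (\sum_(i <- r | P i) f i) <= b.
Proof.
move=> b0 H; apply: (big_ind (fun x => v x <= b)) => //; first by rewrite aval0.
by move=> x y; apply: aval_add_le.
Qed.
End AbsoluteValue.

Section DiscNorm.
Variables (K : closedFieldType) (R : realType) (v : absval K R).
Hypothesis v_nontrivial : av_nontrivial v.

(** Taking n-th roots of an element of absolute value greater than 1 gives value group
elements as close to 1 as desired, and their powers are dense. *)
Lemma aval_dense (s r : R) : 0 <= s -> s < r -> exists z, s < v z < r.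
Proof.
move=> s0 sr; have r0 : 0 < r by apply: le_lt_trans sr.
have [x x1] : exists x, 1 < v x.
  have [x x0 x1] := v_nontrivial; have [lt|le] := ltP 1 (v x); first by exists x.
  by exists x^-1; rewrite avalV invf_gt1 ?aval_gt0 // lt_neqAle x1.
pose t := Num.max s (r / 2).
have t0 : 0 < t by rewrite lt_max divr_gt0 ?orbT.
have tr : t < r by rewrite gt_max sr /=; lra.
have [n xn] : exists n, v x < (r / t) ^+ n.
  by apply: expr_unbounded; rewrite ltr_pdivlMr // mul1r.
have n0 : (0 < n)%N by case: n xn => //; rewrite expr0 ltNge (ltW x1).
have [y yn] : exists y : K, y ^+ n = x.
  have /closed_rootP[y] : size ('X^n - x%:P : {poly K}) != 1%N by rewrite size_XnsubC //; case: n n0 {xn}.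
  by rewrite /root !hornerE subr_eq0 => /eqP; exists y.
have y1 : 1 < v y by rewrite -(expr_gt1 n0) ?aval_ge0 // -avalX yn.
have yr : v y < r / t.
  by rewrite -(ltr_pXn2r n0) ?nnegrE ?aval_ge0 ?divr_ge0 ?(ltW t0) ?(ltW r0) // -avalX yn.
have y0 : 0 < v y by apply: lt_trans y1.
have [N yN] := expr_unbounded t^-1 y1.
have ex : exists m, t < v (y ^+ m / y ^+ N).
  have [m ym] := expr_unbounded (t * v y ^+ N) y1; exists m.
  by rewrite avalM avalV !avalX ltr_pdivlMr // exprn_gt0.
case: (ex_minnP ex) => m tm min; exists (y ^+ m / y ^+ N); apply/andP; split.
  by apply: le_lt_trans tm; rewrite le_max lexx.
case: m tm min => [|m] tm min.
  move: tm; rewrite expr0 mul1r avalV avalX => tm; move: yN; rewrite ltNge; case/negP.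
  rewrite ltW // -[v y ^+ N]invrK ltf_pV2 // posrE ?invr_gt0 ?exprn_gt0 //.
have {}min : v (y ^+ m / y ^+ N) <= t by rewrite leNgt; apply/negP => /min; rewrite ltnn.
rewrite exprS -mulrA avalM -(divfK (lt0r_neq0 t0) r); apply: le_lt_trans (_ : v y * t < _).
  by rewrite ler_pM2l.
by rewrite ltr_pM2r.
Qed.

Lemma aval_horner_prod c (s : seq K) x :
  v (c *: \prod_(z <- s) ('X - z%:P)).[x] = v c * \prod_(z <- s) v (x - z).
Proof.
rewrite hornerZ avalM; congr (_ * _); rewrite horner_prod.
elim/big_rec2: _ => [|w x' y _ <-]; first by rewrite aval1.
by rewrite avalM !hornerE.
Qed.

Lemma aval_horner_prod_le a r c (s : seq K) x : disc v a r x ->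
  v (c *: \prod_(z <- s) ('X - z%:P)).[x] <= v c * \prod_(z <- s) Num.max r (v (a - z)).
Proof.
move=> xa; rewrite aval_horner_prod ler_wpM2l ?aval_ge0 //; apply: ler_prod => w _.
rewrite aval_ge0 /= -(subrKA a x (- w)); apply: aval_add_le; rewrite le_max.
  by rewrite xa.
by rewrite lexx orbT.
Qed.

(** For r > 0 the supremum is approached at the points z at distance t from a, for t in the value
group, less than r and larger than all the |a - w| that are less than r, w a root: there
|z - w| = max(t, |a - w|) for every root w.  In particular the sup-norm is multiplicative. *)
Lemma disc_norm_prod a r c (s : seq K) : 0 <= r ->
  disc_norm v a r (c *: \prod_(z <- s) ('X - z%:P)) =
  v c * \prod_(z <- s) Num.max r (v (a - z)).
Proof.
move=> r0; set f := _ *: _; pose Pi (t : R) := v c * \prod_(z <- s) Num.max t (v (a - z)).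
have vf := aval_horner_prod c s.
have Pi_cont : continuous Pi by apply: prod_max_continuous.
have ub : ubound [set v f.[z] | z in disc v a r] (Pi r).
  by move=> _ [z za <-]; apply: aval_horner_prod_le.
have ne : [set v f.[z] | z in disc v a r] !=set0.
  by exists (v f.[a]); exists a => //; rewrite /disc /= subrr aval0.
apply/le_anti/andP; split; first exact: ge_sup.
have [r00|rn0] := eqVneq r 0.
  apply: ub_le_sup; first by exists (Pi r).
  exists a; first by rewrite /disc /= subrr aval0.
  by rewrite vf; congr (_ * _); apply: eq_bigr => w _; rewrite r00 max_r ?aval_ge0.
have rp : 0 < r by rewrite lt_neqAle eq_sym rn0.
rewrite leNgt; apply/negP; rewrite /disc_norm; set S := sup _ => lt.
have nb : \forall t \near r, S < Pi t := Pi_cont r _ (lt_nbhsr lt).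
have [e /= e0 He] := nb.
pose t0 := \big[Num.max/0]_(w <- s | v (a - w) < r) v (a - w).
have t0r : t0 < r by apply: bigmax_lt.
have t00 : 0 <= t0 by apply: bigmax_ge_id.
have [z /andP[zt zr]] : exists z, Num.max t0 (r - e) < v z < r.
  by apply: aval_dense; [rewrite le_max t00|rewrite gt_max t0r gtrBl].
have zin : disc v a r (z + a) by rewrite /disc /= addrK ltW.
have : S < v f.[z + a].
  have -> : v f.[z + a] = Pi (v z).
    rewrite vf; congr (_ * _); rewrite !big_seq; apply: eq_bigr => w ws.
    have ne_zw : v (a - w) != v z.
      apply/negP => /eqP E; have awr : v (a - w) < r by rewrite E.
      have := le_bigmax_seq 0 w (fun w => v (a - w) < r) (fun w => v (a - w)) ws awr.
      by rewrite leNgt E (le_lt_trans _ zt) // le_max lexx.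
    rewrite -addrA; have [lt'|] := ltP (v (a - w)) (v z); first by rewrite aval_add_dominant.
    by rewrite le_eqVlt eq_sym (negPf ne_zw) /= => lt'; rewrite [z + _]addrC (aval_add_dominant lt').
  apply: He; rewrite /ball /= ger0_norm ?subr_ge0 ?(ltW zr) //.
  by move: zt; rewrite gt_max => /andP[_]; rewrite ltrBlDr -ltrBlDl.
apply/negP; rewrite -leNgt; apply: ub_le_sup; first by exists (Pi r).
by exists (z + a).
Qed.

Lemma disc_norm_closed a r f : 0 <= r -> exists2 s : seq K,
  f = lead_coef f *: \prod_(z <- s) ('X - z%:P) &
  disc_norm v a r f = v (lead_coef f) * \prod_(z <- s) Num.max r (v (a - z)).
Proof.
by move=> r0; have [s E] := closed_field_poly_normal f; exists s; rewrite -?disc_norm_prod -?E.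
Qed.
End DiscNorm.

(** * Points of discs, and the action on norms *)

Section DiscPoints.
Variables (K : closedFieldType) (R : realType) (v : absval K R).
Hypothesis v_nontrivial : av_nontrivial v.
Implicit Types (f g : {poly K}) (a z e : K) (r : R).

Lemma aval_le_disc_norm a r f z : 0 <= r -> disc v a r z -> v f.[z] <= disc_norm v a r f.
Proof.
move=> r0 za; have [s E ->] := disc_norm_closed v_nontrivial a f r0.
by rewrite {1}E; apply: aval_horner_prod_le.
Qed.

Lemma disc_norm_le a r f (b : R) : 0 <= r ->
  (forall z, disc v a r z -> v f.[z] <= b) -> disc_norm v a r f <= b.
Proof.
move=> r0 H; apply: ge_sup; last by move=> _ [z za <-]; apply: H.
by exists (v f.[a]); exists a => //; rewrite /disc /= subrr aval0.
Qed.

Lemma disc_norm_ultra a r f g : 0 <= r ->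
  disc_norm v a r (f + g) <= Num.max (disc_norm v a r f) (disc_norm v a r g).
Proof.
move=> r0; apply: disc_norm_le => // z za; rewrite hornerD.
by apply: aval_add_le; rewrite le_max aval_le_disc_norm ?orbT.
Qed.

Lemma disc_normM a r f g : 0 <= r ->
  disc_norm v a r (f * g) = disc_norm v a r f * disc_norm v a r g.
Proof.
move=> r0; have [s Ef ->] := disc_norm_closed v_nontrivial a f r0.
have [t Eg ->] := disc_norm_closed v_nontrivial a g r0.
rewrite {1}Ef {1}Eg -scalerAl -scalerAr scalerA -big_cat disc_norm_prod //.
by rewrite avalM big_cat /= mulrACA.
Qed.

Lemma disc_normC a r c : 0 <= r -> disc_norm v a r c%:P = v c.
Proof.
move=> r0; have := disc_norm_prod v_nontrivial a c [::] r0.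
by rewrite !big_nil alg_polyC mulr1.
Qed.

Lemma disc_normXsubC a r e : 0 <= r -> disc_norm v a r ('X - e%:P) = Num.max r (v (a - e)).
Proof.
move=> r0; have := disc_norm_prod v_nontrivial a 1 [:: e] r0.
by rewrite !big_seq1 scale1r aval1 mul1r.
Qed.

Lemma disc_norm_ge0 a r f : 0 <= r -> 0 <= disc_norm v a r f.
Proof.
move=> r0; apply: le_trans (aval_ge0 v f.[a]) _.
by apply: aval_le_disc_norm; rewrite // /disc /= subrr aval0.
Qed.

Lemma disc_norm_seminorm a r : 0 <= r -> mult_seminorm v (disc_norm v a r).
Proof.
move=> r0; split=> [f|c|f g|f g]; rewrite ?disc_norm_ge0 ?disc_normC ?disc_normM //.
apply: le_trans (disc_norm_ultra _ _ _ r0) _.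
by rewrite ge_max lerDl lerDr !disc_norm_ge0.
Qed.

Lemma disc_norm_neq0 a r f : 0 < r -> f != 0 -> disc_norm v a r f != 0.
Proof.
move=> r0 f0; have [s _ ->] := disc_norm_closed v_nontrivial a f (ltW r0).
rewrite mulf_neq0 ?aval_eq0 ?lead_coef_eq0 //; apply: (big_ind (fun x => x != 0)).
- exact: oner_neq0.
- exact: mulf_neq0.
- by move=> w _; rewrite gt_eqF // lt_max r0.
Qed.

(** The absolute value makes this defined for all real r, so that r |-> disc_pt a r is a
path on the whole line; disc_pt a 0 is the point a of type I. *)
Definition disc_pt a r : berkA1 v :=
  exist _ (disc_norm v a `|r|) (mem_set (disc_norm_seminorm a (normr_ge0 r))).

Lemma disc_ptE a r : 0 <= r -> seminorm_of (disc_pt a r) = disc_norm v a r.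
Proof. by move=> r0; rewrite /disc_pt /seminorm_of /= ger0_norm. Qed.

Lemma berkA1_inj (s t : berkA1 v) : seminorm_of s = seminorm_of t -> s = t.
Proof. exact: val_inj. Qed.

(** Every nonzero polynomial is a product of linear factors and constants. *)
Lemma seminorm_ext (s t : berkA1 v) :
  (forall e, seminorm_of s ('X - e%:P) = seminorm_of t ('X - e%:P)) -> s = t.
Proof.
move=> H; apply: berkA1_inj; apply/funext => f.
have [_ sC sM _] := seminorm_ofP s; have [_ tC tM _] := seminorm_ofP t.
have [->|f0] := eqVneq f 0; first by rewrite -polyC0 sC tC.
move: f f0; apply: poly_prod_ind => // [c _|p q Hp Hq]; first by rewrite sC tC.
by rewrite sM tM Hp Hq.
Qed.

Lemma zetaE a r : 0 < r -> zeta v a r = Some (disc_pt a r).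
Proof.
move=> r0; rewrite /zeta; case: xgetP => [x -> [s sE <-]|/(_ (Some (disc_pt a r)))/=].
  by congr Some; apply: berkA1_inj; rewrite sE disc_ptE // ltW.
by case; exists (disc_pt a r) => //; rewrite /= disc_ptE // ltW.
Qed.

Lemma typeIE a : typeI v (Some a) = Some (disc_pt a 0).
Proof.
congr Some; apply: seminorm_ext => e; rewrite disc_ptE // disc_normXsubC //.
by rewrite /seminorm_of /= !hornerE max_r ?aval_ge0.
Qed.

Lemma disc_pt_eqE a r b t : 0 <= r -> 0 <= t ->
  disc_pt a r = disc_pt b t <-> r = t /\ v (a - b) <= r.
Proof.
move=> r0 t0; split=> [E|[<- ab]]; last first.
  apply: seminorm_ext => e; rewrite !disc_ptE // !disc_normXsubC //.
  have H x y : v (x - y) <= r -> Num.max r (v (x - e)) <= Num.max r (v (y - e)).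
    move=> xy; rewrite ge_max le_max lexx /= -(subrKA y x (- e)).
    by apply: aval_add_le; rewrite le_max ?xy // lexx orbT.
  by apply/le_anti; rewrite !H // aval_subC.
have H e : Num.max r (v (a - e)) = Num.max t (v (b - e)).
  by rewrite -!disc_normXsubC // -!disc_ptE // E.
have rt : r = t.
  apply/le_anti/andP; split.
    by have := H b; rewrite subrr aval0 [Num.max t _]max_l // => <-; rewrite le_max lexx.
  by have := H a; rewrite subrr aval0 [Num.max r _]max_l // => ->; rewrite le_max lexx.
split=> //; have := H b; rewrite subrr aval0 [Num.max t _]max_l // => E'.
by rewrite rt -E' le_max lexx orbT.
Qed.

End DiscPoints.

Lemma reflect_matchE (T : Type) (P : Prop) (b : bool) (r : reflect P b) (h : P -> T) d (p : P) :
  (forall p1 p2 : P, p1 = p2) -> (if r is ReflectT q then h q else d) = h p.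
Proof. by move=> irr; case: r => [q|/(_ p)//]; rewrite (irr q p). Qed.

Section Action.
Variables (K : closedFieldType) (R : realType) (v : absval K R).
Implicit Types (phi psi : ratfun K) (s t : berkA1 v).

(** These are the points that are not of type I: a nonconstant rational function has no pole
at them and maps them to such points, so the action can be computed with absolute values. *)
Definition is_norm s := forall f, f != 0 -> seminorm_of s f != 0.

Lemma seminorm_rat_frac s f g : is_norm s -> g != 0 ->
  seminorm_rat s (tofrac f / tofrac g) = seminorm_of s f / seminorm_of s g.
Proof.
move=> ns g0; have [_ _ sM _] := seminorm_ofP s.
have [E _] := rden_dvd g0 (erefl (tofrac f / tofrac g)).
by apply/eqP; rewrite /seminorm_rat eqr_div ?ns ?rden_neq0 // -!sM E.
Qed.

Lemma seminorm_rat_poly s f : is_norm s -> seminorm_rat s (tofrac f) = seminorm_of s f.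
Proof.
move=> ns; have [_ sC _ _] := seminorm_ofP s.
have := seminorm_rat_frac f ns (oner_neq0 {poly K}); rewrite rmorph1 divr1 => ->.
by rewrite -[1]/(1%:P) sC aval1 divr1.
Qed.

Lemma seminorm_rat_div s phi psi : is_norm s -> psi != 0 ->
  seminorm_rat s (phi / psi) = seminorm_rat s phi / seminorm_rat s psi.
Proof.
move=> ns p0; have [_ _ sM _] := seminorm_ofP s.
rewrite ratfun_divE seminorm_rat_frac ?mulf_neq0 ?rden_neq0 ?rnum_eq0 // !sM -mulf_div.
by rewrite /seminorm_rat invf_div.
Qed.

Lemma berk_actE psi s (reg : seminorm_of s (rden psi) != 0) :
  berk_act psi (Some s) = berk_pt (pushforward_seminorm reg).
Proof.
by apply: (reflect_matchE idP (fun h => berk_pt (pushforward_seminorm h))); apply: bool_irrelevance.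
Qed.

Lemma seminorm_rat_neq0 s phi : is_norm s -> phi != 0 -> seminorm_rat s phi != 0.
Proof.
by move=> ns p0; rewrite mulf_neq0 ?invr_eq0 ?ns ?rden_neq0 ?rnum_eq0.
Qed.

(** The norm extends to an absolute value on the rational functions, and acting by psi is
pulling it back along composition with psi. *)
Lemma berk_act_norm psi s : is_norm s -> transcendental psi ->
  exists t, [/\ berk_act psi (Some s) = Some t, is_norm t &
    forall phi, seminorm_rat t phi = seminorm_rat s (ratcomp phi psi)].
Proof.
move=> ns tr; have reg : seminorm_of s (rden psi) != 0 by rewrite ns ?rden_neq0.
pose t : berkA1 v := exist _ (fun h => seminorm_rat s (poly_at h psi))
  (mem_set (pushforward_seminorm reg)).
exists t; split.
- exact: berk_actE.
- by move=> f f0; apply: seminorm_rat_neq0 => //; apply: poly_at_neq0 tr _ f0.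
- by move=> phi; rewrite /ratcomp seminorm_rat_div // (poly_at_neq0 tr) ?rden_neq0.
Qed.

Lemma ratcomp_transc phi psi : transcendental phi -> transcendental psi ->
  transcendental (ratcomp phi psi).
Proof.
move=> t1 t2; split=> p p0.
by rewrite -ratcomp_poly_at // mulf_neq0 ?invr_eq0 ?poly_at_neq0 ?rden_neq0 ?rnum_eq0 ?poly_at_neq0.
Qed.

Lemma seminorm_rat_inj s t : is_norm s -> is_norm t ->
  (forall phi, seminorm_rat s phi = seminorm_rat t phi) -> s = t.
Proof.
move=> ns nt H; apply: berkA1_inj; apply/funext => f.
by rewrite -!seminorm_rat_poly.
Qed.

Lemma berk_act_comp phi psi s : is_norm s -> transcendental phi -> transcendental psi ->
  berk_act (ratcomp phi psi) (Some s) = berk_act phi (berk_act psi (Some s)).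
Proof.
move=> ns t1 t2; have [t [-> nt tE]] := berk_act_norm ns t2.
have [u [-> nu uE]] := berk_act_norm nt t1.
have [w [-> nw wE]] := berk_act_norm ns (ratcomp_transc t1 t2).
by congr Some; apply: seminorm_rat_inj => // h; rewrite wE uE tE ratcompA.
Qed.

Lemma berk_act_id s : is_norm s -> berk_act (tofrac 'X) (Some s) = Some s.
Proof.
move=> ns; have [t [-> nt tE]] := berk_act_norm ns (@transc_tofracX K).
by congr Some; apply: seminorm_rat_inj => // h; rewrite tE ratcomp1.
Qed.

(** By multiplicativity it is enough to compare both sides on the X - e, and the pushforward
of s takes X - e to s(f - e g) / s(g). *)
Lemma berk_act_frac psi f g s t : is_norm s -> transcendental psi -> g != 0 ->
  psi = tofrac f / tofrac g ->
  berk_act psi (Some s) = Some t <->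
  forall e, seminorm_of s (f - e *: g) = seminorm_of s g * seminorm_of t ('X - e%:P).
Proof.
move=> ns tr g0 E; have [u [-> nu uE]] := berk_act_norm ns tr.
have H e : seminorm_of u ('X - e%:P) = seminorm_of s (f - e *: g) / seminorm_of s g.
  rewrite -seminorm_rat_poly // uE (@ratcompE _ _ _ ('X - e%:P) 1) ?oner_neq0 //.
    have -> : poly_at 1 psi = 1 by rewrite -[1]/(1%:P) poly_atC rmorph1.
    rewrite divr1 -polyCN poly_atD poly_atX poly_atC polyCN rmorphN -seminorm_rat_frac //.
    rewrite E; congr seminorm_rat; rewrite -mul_polyC rmorphB rmorphM /= mulrBl mulfK //.
    by rewrite tofrac_neq0.
  by rewrite rmorph1 divr1.
split=> [[<-] e|H']; first by rewrite H mulrC divfK ?ns.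
by congr Some; apply: seminorm_ext => e; rewrite H H' mulrAC divff ?mul1r ?ns.
Qed.

End Action.

(** * Two by two matrices over the ring of integers *)

Lemma ord2P (i : 'I_2) : i = 0 \/ i = 1.
Proof. by case: i => [[|[|i]] //= H]; [left|right]; apply/val_inj. Qed.

Section Matrices.
Variable F : fieldType.
Implicit Types (a b c d u x y : F) (M : 'M[F]_2).

Definition mx2 a b c d : 'M[F]_2 :=
  \matrix_(i, j) if i == 0 then if j == 0 then a else b else if j == 0 then c else d.

Lemma mx2_00 a b c d : mx2 a b c d 0 0 = a. Proof. by rewrite mxE. Qed.
Lemma mx2_01 a b c d : mx2 a b c d 0 1 = b. Proof. by rewrite mxE. Qed.
Lemma mx2_10 a b c d : mx2 a b c d 1 0 = c. Proof. by rewrite mxE. Qed.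
Lemma mx2_11 a b c d : mx2 a b c d 1 1 = d. Proof. by rewrite mxE. Qed.
Definition mx2E := (mx2_00, mx2_01, mx2_10, mx2_11).

Lemma det_mx2 a b c d : \det (mx2 a b c d) = a * d - b * c.
Proof. by rewrite det2 !mx2E. Qed.

Lemma eq_mx2 M M' : M 0 0 = M' 0 0 -> M 0 1 = M' 0 1 -> M 1 0 = M' 1 0 ->
  M 1 1 = M' 1 1 -> M = M'.
Proof.
by move=> *; apply/matrixP => i j; case: (ord2P i) => ->; case: (ord2P j) => ->.
Qed.

Lemma mul_mx2 M M' : M *m M' = mx2
  (M 0 0 * M' 0 0 + M 0 1 * M' 1 0) (M 0 0 * M' 0 1 + M 0 1 * M' 1 1)
  (M 1 0 * M' 0 0 + M 1 1 * M' 1 0) (M 1 0 * M' 0 1 + M 1 1 * M' 1 1).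
Proof. by apply: eq_mx2; rewrite !mxE /= big_ord2. Qed.

Lemma unitmx2 M : (M \in unitmx) = (M 0 0 * M 1 1 - M 0 1 * M 1 0 != 0).
Proof. by rewrite unitmxE unitfE det2. Qed.

Lemma mobius_scale u M : u != 0 -> mobius (u *: M) = mobius M.
Proof.
move=> u0; rewrite !mobiusE !mxE.
have E a b : lin (u * a) (u * b) = u%:P * lin a b.
  by rewrite /lin mulrDr -!mul_polyC !rmorphM /= mulrA.
rewrite !E !rmorphM /= -mulf_div divff ?mul1r //.
by rewrite tofrac_eq0 polyC_eq0.
Qed.

Lemma unitmx_scale u M : u != 0 -> (u *: M \in unitmx) = (M \in unitmx).
Proof. by move=> u0; rewrite unitmxZ // unitfE. Qed.

Lemma rat_eval_mobiusM M M' (x : P1 F) : M \in unitmx -> M' \in unitmx ->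
  rat_eval (mobius (M *m M')) x = rat_eval (mobius M) (rat_eval (mobius M') x).
Proof.
move=> M1 M'1; have x0 := hcoord_neq0 x; rewrite -[x]hcoordK !mobius_eval ?unitmx_mul ?M1 //.
  by rewrite mul_mx2 !mx2E; congr toP1; ring.
exact: mobius_coord_neq0.
Qed.

Lemma rat_eval_mobius1 (x : P1 F) : rat_eval (mobius (1%:M : 'M[F]_2)) x = x.
Proof.
rewrite -{1}[x]hcoordK mobius_eval ?unitmx1 ?hcoord_neq0 // !mxE /=.
by rewrite !mul1r !mul0r addr0 add0r hcoordK.
Qed.

Lemma mobiusK M (x : P1 F) : M \in unitmx ->
  rat_eval (mobius (invmx M)) (rat_eval (mobius M) x) = x.
Proof. by move=> M1; rewrite -rat_eval_mobiusM ?unitmx_inv // mulVmx // rat_eval_mobius1. Qed.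

Lemma mobiusVK M (x : P1 F) : M \in unitmx ->
  rat_eval (mobius M) (rat_eval (mobius (invmx M)) x) = x.
Proof. by move=> M1; rewrite -rat_eval_mobiusM ?unitmx_inv // mulmxV // rat_eval_mobius1. Qed.

End Matrices.

Section IntegralMatrices.
Variables (K : fieldType) (R : realType) (v : absval K R).
Implicit Types (a b x y : K) (k : 'M[K]_2).

(** Membership in GL_2 of the ring of integers. *)
Definition GL2O k := (forall i j, v (k i j) <= 1) /\ v (\det k) = 1.

Lemma GL2O_unit k : GL2O k -> k \in unitmx.
Proof. by case=> _ dk; rewrite unitmxE unitfE -(aval_eq0 v) dk oner_neq0. Qed.

Lemma avalM_le1 x y : v x <= 1 -> v y <= 1 -> v (x * y) <= 1.
Proof. by move=> x1 y1; rewrite avalM mulr_ile1 ?aval_ge0. Qed.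

Lemma GL2O_inv k : GL2O k -> GL2O (invmx k).
Proof.
move=> Gk; have k1 := GL2O_unit Gk; have [ki dk] := Gk; split; last first.
  by rewrite det_inv avalV dk invr1.
move=> i j; rewrite /invmx k1 !mxE avalM_le1 ?avalV ?dk ?invr1 // /cofactor det_mx11 !mxE.
by rewrite avalM_le1 // avalX avalN aval1 expr1n.
Qed.

(** The matrix and its inverse both do not increase the norm. *)
Lemma GL2O_max_aval k x y : GL2O k ->
  Num.max (v (k 0 0 * x + k 0 1 * y)) (v (k 1 0 * x + k 1 1 * y)) = Num.max (v x) (v y).
Proof.
have le h z w : GL2O h -> Num.max (v (h 0 0 * z + h 0 1 * w)) (v (h 1 0 * z + h 1 1 * w))
    <= Num.max (v z) (v w).
  move=> [hi _]; have E i j t : v t <= Num.max (v z) (v w) -> v (h i j * t) <= Num.max (v z) (v w).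
    by apply: le_trans; rewrite avalM ler_piMl ?aval_ge0.
  by rewrite ge_max !aval_add_le ?E ?le_max ?lexx ?orbT.
move=> Gk; apply/le_anti; rewrite le //=.
have k1 := GL2O_unit Gk; have := le _ (k 0 0 * x + k 0 1 * y) (k 1 0 * x + k 1 1 * y) (GL2O_inv Gk).
have := mulVmx k1; set n := invmx k; rewrite mul_mx2 => E.
have E0 := congr1 (fun A : 'M[K]_2 => A 0 0) E; have E1 := congr1 (fun A : 'M[K]_2 => A 0 1) E.
have E2 := congr1 (fun A : 'M[K]_2 => A 1 0) E; have E3 := congr1 (fun A : 'M[K]_2 => A 1 1) E.
rewrite /= !mx2E !mxE /= in E0 E1 E2 E3.
have X i : n i 0 * (k 0 0 * x + k 0 1 * y) + n i 1 * (k 1 0 * x + k 1 1 * y) =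
    (n i 0 * k 0 0 + n i 1 * k 1 0) * x + (n i 0 * k 0 1 + n i 1 * k 1 1) * y by ring.
by rewrite !X E0 E1 E2 E3 !mul1r !mul0r addr0 add0r.
Qed.

Lemma max_aval_gt0 x y : (x != 0) || (y != 0) -> 0 < Num.max (v x) (v y).
Proof. by rewrite lt_max !aval_gt0. Qed.

(** The chordal metric does not depend on the choice of homogeneous coordinates. *)
Lemma chordal_toP1 x y x' y' : (x != 0) || (y != 0) -> (x' != 0) || (y' != 0) ->
  chordal v (toP1 x y) (toP1 x' y') =
  v (x * y' - y * x') / (Num.max (v x) (v y) * Num.max (v x') (v y')).
Proof.
move=> h h'; have [c c0 [Ex Ey]] := toP1_hcoord h; have [c' c'0 [Ex' Ey']] := toP1_hcoord h'.
rewrite /chordal; move: (hcoord (toP1 x y)) (hcoord (toP1 x' y')) Ex Ey Ex' Ey'.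
move=> [X Y] [X' Y'] /= Ex Ey Ex' Ey'.
have m0 : 0 < Num.max (v X) (v Y).
  by have := max_aval_gt0 h; rewrite Ex Ey !avalM -maxr_pMr ?aval_ge0 // pmulr_rgt0 ?aval_gt0.
have m'0 : 0 < Num.max (v X') (v Y').
  by have := max_aval_gt0 h'; rewrite Ex' Ey' !avalM -maxr_pMr ?aval_ge0 // pmulr_rgt0 ?aval_gt0.
have -> : x * y' - y * x' = c * c' * (X * Y' - Y * X') by rewrite Ex Ey Ex' Ey'; ring.
rewrite Ex Ey Ex' Ey' !avalM -!maxr_pMr ?aval_ge0 //.
have vc : v c != 0 by rewrite aval_eq0.
have vc' : v c' != 0 by rewrite aval_eq0.
by field; rewrite vc vc' !gt_eqF.
Qed.

Lemma primitive_coord (x : P1 K) : exists a b, Num.max (v a) (v b) = 1 /\ x = toP1 a b.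
Proof.
case: x => [a|]; last by exists 1, 0; rewrite aval1 aval0 max_l // /toP1 eqxx.
have [a1|a1] := leP (v a) 1.
  by exists a, 1; rewrite aval1 max_r // /toP1 oner_eq0 divr1.
have a0 : a != 0 by rewrite -(aval_gt0 v) (lt_trans ltr01 a1).
exists 1, a^-1; rewrite aval1 avalV max_l ?invf_le1 ?(ltW a1) ?aval_gt0 //.
by rewrite /toP1 invr_eq0 (negPf a0) invrK mul1r.
Qed.

End IntegralMatrices.

(** * The Gauss point and its stabilizer *)

Section GaussPoint.
Variables (K : closedFieldType) (R : realType) (v : absval K R).
Hypothesis v_nontrivial : av_nontrivial v.
Implicit Types (f g : {poly K}) (a b c e : K) (r : R) (M k : 'M[K]_2).

Local Notation zpt := (disc_pt v_nontrivial).

(** The Cauchy estimates, by induction on the number of linear factors. *)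
Lemma disc_norm_coef r f i : 0 <= r -> v f`_i * r ^+ i <= disc_norm v 0 r f.
Proof.
move=> r0; have [s E ->] := disc_norm_closed v_nontrivial 0 f r0.
rewrite {1}E coefZ avalM -mulrA ler_wpM2l ?aval_ge0 //.
elim: s {E} i => [|z s IH] i.
  rewrite !big_nil coef1; case: i => [|i]; first by rewrite aval1 expr0 mulr1.
  by rewrite aval0 mul0r ler01.
rewrite !big_cons; set q := \prod_(_ <- s) _ in IH *; set m := \prod_(_ <- s) _ in IH *.
have m0 : 0 <= m by apply: prodr_ge0 => w _; rewrite le_max r0.
rewrite mulrBl coefB mul_polyC coefZ coefXM.
have [->|iz] := eqVneq i 0%N.
  rewrite sub0r avalN expr0 mulr1 avalM; have := IH 0%N; rewrite expr0 mulr1 => H.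
  by apply: ler_pM; rewrite ?aval_ge0 // sub0r avalN le_max lexx orbT.
case: i iz => // i _ /=; have ri : 0 <= r ^+ i.+1 by rewrite exprn_ge0.
have [le|/ltW le] := leP (v (z * q`_i.+1)) (v q`_i).
  apply: (@le_trans _ _ (v q`_i * r ^+ i.+1)).
    by rewrite ler_wpM2r // aval_add_le // avalN.
  rewrite exprS mulrCA; apply: ler_pM; rewrite ?le_max ?lexx // mulr_ge0 ?aval_ge0 //.
  by rewrite exprn_ge0.
apply: (@le_trans _ _ (v (z * q`_i.+1) * r ^+ i.+1)).
  by rewrite ler_wpM2r // aval_add_le // avalN.
rewrite avalM -mulrA; apply: ler_pM; rewrite ?aval_ge0 ?mulr_ge0 ?aval_ge0 //.
by rewrite sub0r avalN le_max lexx orbT.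
Qed.

Lemma disc01 z : disc v 0 1 z = (v z <= 1) :> Prop.
Proof. by rewrite /disc /= subr0. Qed.

Lemma gauss_le f (b : R) : 0 <= b -> (forall i, v f`_i <= b) -> disc_norm v 0 1 f <= b.
Proof.
move=> b0 H; apply: disc_norm_le => // z; rewrite disc01 => z1.
rewrite horner_coef; apply: aval_sum_le => // i _.
by rewrite avalM avalX -[b]mulr1 ler_pM ?aval_ge0 ?exprn_ge0 ?exprn_ile1 ?aval_ge0.
Qed.

Lemma gauss_lt1 f : (forall i, v f`_i < 1) -> disc_norm v 0 1 f < 1.
Proof.
move=> H; pose b := \big[Num.max/0]_(i < size f) v f`_i.
have b1 : b < 1 by apply: bigmax_lt.
have b0 : 0 <= b by apply: bigmax_ge_id.
apply: le_lt_trans b1; apply: gauss_le => // i.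
have [lt|le] := ltnP i (size f); last by rewrite nth_default ?aval0.
exact: (le_bigmax _ (fun i : 'I_(size f) => v f`_i) (Ordinal lt)).
Qed.

Lemma gauss_coef f i : v f`_i <= disc_norm v 0 1 f.
Proof. by have := disc_norm_coef f i (@ler01 R); rewrite expr1n mulr1. Qed.

Lemma gauss_lin a b : disc_norm v 0 1 (lin a b) = Num.max (v a) (v b).
Proof.
apply/le_anti/andP; split.
  apply: gauss_le => [|i]; first by rewrite le_max aval_ge0.
  by rewrite coef_lin; case: i => [|[|i]]; rewrite le_max ?lexx ?orbT ?aval0 ?aval_ge0.
rewrite ge_max; have := gauss_coef (lin a b) 0; have := gauss_coef (lin a b) 1.
by rewrite !coef_lin => -> ->.
Qed.

Lemma zetaGE : zetaG v = Some (zpt 0 1).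
Proof. exact: zetaE. Qed.

Lemma disc_pt_norm a r : 0 < r -> is_norm (zpt a r).
Proof. by move=> r0 f f0; rewrite disc_ptE ?ltW // disc_norm_neq0. Qed.

Lemma lin_subZ a b c d e : lin a b - e *: lin c d = lin (a - e * c) (b - e * d).
Proof. by rewrite -scaleNr -[lin a b]scale1r lin_comb !mul1r !mulNr. Qed.

(** The Gauss norm of a linear polynomial is the larger of its two coefficients. *)
Lemma mobius_zetaG M t : M \in unitmx ->
  berk_act (mobius M) (zetaG v) = Some t <->
  forall e, Num.max (v (M 0 0 - e * M 1 0)) (v (M 0 1 - e * M 1 1)) =
    Num.max (v (M 1 0)) (v (M 1 1)) * seminorm_of t ('X - e%:P).
Proof.
move=> M1; have [_ _ g0 E] := mobius_lift M1; rewrite zetaGE.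
rewrite (berk_act_frac _ (disc_pt_norm 0 ltr01) (mobius_transc M1) g0 E).
by split=> H e; have := H e; rewrite lin_subZ !disc_ptE // !gauss_lin.
Qed.

(** Apply the invariance of the max-norm to the transposed matrix and the row (1, -e). *)
Lemma GL2O_zetaG k : GL2O v k -> berk_act (mobius k) (zetaG v) = zetaG v.
Proof.
move=> Gk; rewrite [RHS]zetaGE; apply/mobius_zetaG => [|e]; first exact: GL2O_unit Gk.
have [ki dk] := Gk; have k1 := GL2O_unit Gk.
have kt : GL2O v (k^T) by split=> [i j|]; rewrite ?det_tr // mxE.
have := GL2O_max_aval 0 1 kt; rewrite !mxE !mulr0 !mulr1 !add0r aval0 aval1 => ->.
have := GL2O_max_aval 1 (- e) kt; rewrite !mxE !mulr1 !mulrN ![_ * e]mulrC => ->.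
by rewrite [Num.max 0 1]max_r ?ler01 // mul1r disc_ptE // disc_normXsubC // sub0r avalN aval1.
Qed.

(** One entry of the second row has absolute value 1.  Testing with the e that cancels the
entry above it leaves the determinant, up to a factor of absolute value 1. *)
Lemma zetaG_stabilizer_normalized k : Num.max (v (k 1 0)) (v (k 1 1)) = 1 ->
  (forall e, Num.max (v (k 0 0 - e * k 1 0)) (v (k 0 1 - e * k 1 1)) = Num.max 1 (v e)) ->
  GL2O v k.
Proof.
move=> m1 H; have m0 : Num.max (v (k 0 0)) (v (k 0 1)) = 1.
  by have := H 0; rewrite !mul0r !subr0 aval0 [Num.max 1 0]max_l.
have ki i j : v (k i j) <= 1.
  by case: (ord2P i) => ->; [rewrite -m0|rewrite -m1]; case: (ord2P j) => ->;
    rewrite le_max lexx ?orbT.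
split=> //; rewrite det2.
have [k0|k0] : v (k 1 0) = 1 \/ v (k 1 1) = 1.
  by move: m1; case: leP => _; [right|left].
- have n0 : k 1 0 != 0 by rewrite -(aval_eq0 v) k0 oner_neq0.
  have := H (k 0 0 / k 1 0); rewrite divfK // subrr aval0 avalM avalV k0 invr1 mulr1.
  rewrite [Num.max 1 _]max_l ?ki // max_r ?aval_ge0 // => <-.
  rewrite -[RHS]mulr1 -k0 -avalM aval_subC; congr (aval _ _); field.
  by rewrite n0.
- have n0 : k 1 1 != 0 by rewrite -(aval_eq0 v) k0 oner_neq0.
  have := H (k 0 1 / k 1 1); rewrite divfK // subrr aval0 avalM avalV k0 invr1 mulr1.
  rewrite [Num.max 1 _]max_l ?ki // max_l ?aval_ge0 // => <-.
  by rewrite -[RHS]mulr1 -k0 -avalM; congr (aval _ _); field; rewrite n0.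
Qed.

(** Dividing by an entry of largest absolute value of the second row reduces this to
[zetaG_stabilizer_normalized]. *)
Lemma zetaG_stabilizer k : k \in unitmx -> berk_act (mobius k) (zetaG v) = zetaG v ->
  exists2 u, u != 0 & GL2O v (u *: k).
Proof.
move=> k1; rewrite [in RHS]zetaGE => /(mobius_zetaG _ k1) H.
set m := Num.max (v (k 1 0)) (v (k 1 1)) in H.
have [u um] : exists u, v u * m = 1.
  have m0 : 0 < m.
    rewrite lt_max !aval_gt0 -negb_and; apply/negP => /andP[/eqP a /eqP b].
    by move: k1; rewrite unitmx2 a b !mulr0 subr0 eqxx.
  have [x mx] : exists x, m = v x by rewrite /m; case: leP => _; eexists.
  by exists x^-1; rewrite avalV mx mulVf // -mx gt_eqF.
exists u.
  by apply: contraTneq isT => u0; move/eqP: um; rewrite u0 aval0 mul0r eq_sym oner_eq0.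
apply: zetaG_stabilizer_normalized; rewrite !mxE.
  by rewrite !avalM -maxr_pMr ?aval_ge0.
move=> e; rewrite !(mulrCA e u) -!mulrBr !avalM -maxr_pMr ?aval_ge0 // H mulrA um mul1r.
by rewrite disc_ptE // disc_normXsubC // sub0r avalN.
Qed.

(** The affine map z |-> c z + a. *)
Definition affine_mx c a : 'M[K]_2 := mx2 c a 0 1.

Lemma affine_mx_unit c a : c != 0 -> affine_mx c a \in unitmx.
Proof. by move=> c0; rewrite unitmx2 !mx2E mulr1 mulr0 subr0. Qed.

Lemma affine_mx_zetaG c a : c != 0 -> berk_act (mobius (affine_mx c a)) (zetaG v) = zeta v a (v c).
Proof.
move=> c0; rewrite zetaE ?aval_gt0 //; apply/mobius_zetaG => [|e]; first exact: affine_mx_unit.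
rewrite !mx2E mulr0 subr0 mulr1 aval0 aval1 [Num.max 0 _]max_r ?ler01 // mul1r.
by rewrite disc_ptE ?aval_ge0 // disc_normXsubC ?aval_ge0.
Qed.

(** The inversion z |-> 1/z. *)
Definition winv : 'M[K]_2 := mx2 0 1 1 0.

Lemma winv_unit : winv \in unitmx.
Proof. by rewrite unitmx2 !mx2E mul0r mul1r sub0r oppr_eq0 oner_eq0. Qed.

Lemma mobius_winv : mobius winv = (tofrac 'X)^-1.
Proof.
by rewrite mobiusE !mx2E /lin scale0r scale1r add0r addr0 rmorph1 mul1r.
Qed.

Lemma winvK : winv *m winv = 1%:M.
Proof. by rewrite mul_mx2 !mx2E; apply: eq_mx2; rewrite !mx2E !mxE /=; ring. Qed.

Lemma berk_act_mobiusM M k : M \in unitmx -> k \in unitmx ->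
  berk_act (mobius (M *m k)) (zetaG v) = berk_act (mobius M) (berk_act (mobius k) (zetaG v)).
Proof.
move=> M1 k1; rewrite -ratcomp_mobius // zetaGE berk_act_comp //; try exact: mobius_transc.
exact: disc_pt_norm.
Qed.

(** The inversion takes zeta_{a,|c|} to zeta_{0,1/|c|} when 0 lies in the disc, and to
zeta_{1/a, |c/a^2|} otherwise; in both cases the matrix of z |-> 1/(c z + a) is the new
affine matrix times an element of GL_2 over the ring of integers. *)
Lemma winv_typeII a c : c != 0 -> exists b c', c' != 0 /\
  berk_act (tofrac 'X)^-1 (zeta v a (v c)) = zeta v b (v c').
Proof.
move=> c0; rewrite -mobius_winv -affine_mx_zetaG //.
rewrite -berk_act_mobiusM ?winv_unit ?affine_mx_unit //.
have [le|lt] := leP (v a) (v c).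
  exists 0, c^-1; rewrite invr_eq0; split=> //; rewrite -affine_mx_zetaG ?invr_eq0 //.
  have Gk : GL2O v (mx2 0 1 1 (a / c)).
    split=> [i j|]; last by rewrite det_mx2 mul0r mul1r sub0r avalN aval1.
    case: (ord2P i) => ->; case: (ord2P j) => ->; rewrite mx2E ?aval0 ?aval1 ?ler01 //.
    by rewrite avalM avalV ler_pdivrMr ?aval_gt0 // mul1r.
  rewrite -[in RHS](GL2O_zetaG Gk) -berk_act_mobiusM ?affine_mx_unit ?invr_eq0 ?(GL2O_unit Gk) //.
  rewrite -(mobius_scale (winv *m affine_mx c a) (_ : c^-1 != 0)) ?invr_eq0 //; congr (berk_act (mobius _)).
  by rewrite !mul_mx2; apply: eq_mx2; rewrite ?mxE /= ?mx2E; field; rewrite ?c0.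
have a0 : a != 0 by rewrite -(aval_gt0 v) (le_lt_trans _ lt) ?aval_ge0.
exists a^-1, (- c / a ^+ 2).
have c'0 : - c / a ^+ 2 != 0 by rewrite mulf_neq0 ?oppr_eq0 // invr_eq0 expf_neq0.
split=> //; rewrite -affine_mx_zetaG //.
have Gk : GL2O v (mx2 1 0 (c / a) 1).
  split=> [i j|]; last by rewrite det_mx2 mul0r mul1r subr0 aval1.
  case: (ord2P i) => ->; case: (ord2P j) => ->; rewrite mx2E ?aval0 ?aval1 ?ler01 //.
  by rewrite avalM avalV ler_pdivrMr ?aval_gt0 // mul1r ltW.
rewrite -[in RHS](GL2O_zetaG Gk) -berk_act_mobiusM ?affine_mx_unit ?(GL2O_unit Gk) //.
rewrite -(mobius_scale (winv *m affine_mx c a) (_ : a^-1 != 0)) ?invr_eq0 //; congr (berk_act (mobius _)).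
by rewrite !mul_mx2; apply: eq_mx2; rewrite ?mxE /= ?mx2E; field; rewrite ?a0.
Qed.

End GaussPoint.

(** * Reduction modulo the maximal ideal *)

Section Reduction.
Variables (K : fieldType) (R : realType) (v : absval K R) (kappa : fieldType).
Variable red : residue_map v kappa.
Implicit Types (f g : {poly K}) (a b x y : K).

Lemma red_small x : v x < 1 -> red x = 0.
Proof. by move=> x1; apply/eqP; rewrite red_eq0 ?ltW. Qed.

Lemma red0 : red 0 = 0.
Proof. by apply: red_small; rewrite aval0 ltr01. Qed.

Lemma red_neq0 x : v x = 1 -> red x != 0.
Proof. by move=> x1; rewrite red_eq0 x1 ?ltxx. Qed.

Lemma red_div a b : v a <= 1 -> v b = 1 -> red (a / b) = red a / red b.
Proof.
move=> a1 b1; have b0 : b != 0 by rewrite -(aval_eq0 v) b1 oner_neq0.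
apply: (mulIf (red_neq0 b1)); rewrite divfK ?red_neq0 // -redM ?b1 ?divfK //.
by rewrite avalM avalV b1 invr1 mulr1.
Qed.

Lemma red_toP1 a b : Num.max (v a) (v b) = 1 ->
  red_P1 red (toP1 a b) = toP1 (red a) (red b).
Proof.
move=> m1; have a1 : v a <= 1 by rewrite -m1 le_max lexx.
have b1 : v b <= 1 by rewrite -m1 le_max lexx orbT.
rewrite /toP1 red_eq0 //; have [bl|bl] := ltP (v b) 1.
  have va : v a = 1 by move: m1; case: leP => // _ E; rewrite E ltxx in bl.
  have [//|b0] := eqVneq b 0.
  rewrite /red_P1 avalM avalV va mul1r invf_le1 ?aval_gt0 // leNgt bl //.
have vb : v b = 1 by apply/le_anti; rewrite b1 bl.
have b0 : b != 0 by rewrite -(aval_eq0 v) vb oner_neq0.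
by rewrite (negPf b0) /red_P1 avalM avalV vb invr1 mulr1 a1 red_div.
Qed.

Lemma GL2O_red_unit (k : 'M[K]_2) : GL2O v k -> map_mx red k \in unitmx.
Proof.
move=> [ki dk]; rewrite unitmx2 !mxE -!redM //; rewrite det2 in dk.
have := red_neq0 dk; rewrite redD ?avalN ?avalM_le1 //.
suff -> : red (- (k 0 1 * k 1 0)) = - red (k 0 1 * k 1 0) by [].
apply/eqP; rewrite -subr_eq0 opprK -redD ?avalN ?avalM_le1 // addNr.
by rewrite red0.
Qed.

Lemma red_mobius (k : 'M[K]_2) (x : P1 K) : GL2O v k ->
  red_P1 red (rat_eval (mobius k) x) = rat_eval (mobius (map_mx red k)) (red_P1 red x).
Proof.
move=> Gk; have [a [b [ab ->]]] := primitive_coord v x; have [ki dk] := Gk.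
have k1 := GL2O_unit Gk.
have a1 : v a <= 1 by rewrite -ab le_max lexx.
have b1 : v b <= 1 by rewrite -ab le_max lexx orbT.
have ab0 : (a != 0) || (b != 0).
  by rewrite -!(aval_gt0 v) -lt_max ab ltr01.
have rab0 : (red a != 0) || (red b != 0).
  by move: ab; case: leP => _ /red_neq0 ->; rewrite ?orbT.
rewrite mobius_eval // !red_toP1 ?GL2O_max_aval // mobius_eval ?GL2O_red_unit // !mxE.
by rewrite !redD ?avalM_le1 // !redM.
Qed.

Definition int_poly f := forall i, v f`_i <= 1.

Lemma coef_red f i : (red_poly red f)`_i = red f`_i.
Proof. by rewrite coef_map_id0 ?red0. Qed.

Lemma red_big_sum I (r : seq I) (F : I -> K) : (forall i, v (F i) <= 1) ->
  v (\sum_(i <- r) F i) <= 1 /\ red (\sum_(i <- r) F i) = \sum_(i <- r) red (F i).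
Proof.
move=> H; elim: r => [|i r [IH1 IH2]]; first by rewrite !big_nil red0 aval0 ler01.
by rewrite !big_cons aval_add_le // redD // IH2.
Qed.

Lemma red_polyD f g : int_poly f -> int_poly g -> red_poly red (f + g) = red_poly red f + red_poly red g.
Proof. by move=> fi gi; apply/polyP => i; rewrite !(coef_red, coefD) redD. Qed.

Lemma int_polyD f g : int_poly f -> int_poly g -> int_poly (f + g).
Proof. by move=> fi gi i; rewrite coefD aval_add_le. Qed.

Lemma int_polyM f g : int_poly f -> int_poly g -> int_poly (f * g).
Proof.
move=> fi gi i; rewrite coefM; apply: (red_big_sum _ _).1 => j; exact: avalM_le1.
Qed.

Lemma red_polyM f g : int_poly f -> int_poly g -> red_poly red (f * g) = red_poly red f * red_poly red g.
Proof.
move=> fi gi; apply/polyP => i; rewrite coef_red !coefM.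
have H (j : 'I_i.+1) : v (f`_j * g`_(i - j)) <= 1 by exact: avalM_le1.
rewrite (red_big_sum _ H).2; apply: eq_bigr => j _.
by rewrite !coef_red redM.
Qed.

Lemma red_polyC c : red_poly red c%:P = (red c)%:P.
Proof. by apply/polyP => i; rewrite coef_red !coefC; case: eqP => //; rewrite red0. Qed.

Lemma int_polyC c : v c <= 1 -> int_poly c%:P.
Proof. by move=> c1 i; rewrite coefC; case: eqP => //; rewrite aval0 ler01. Qed.

Lemma int_polyZ c f : v c <= 1 -> int_poly f -> int_poly (c *: f).
Proof. by move=> c1 fi; rewrite -mul_polyC; apply: int_polyM; first exact: int_polyC. Qed.

Lemma red_polyZ c f : v c <= 1 -> int_poly f -> red_poly red (c *: f) = red c *: red_poly red f.
Proof. by move=> c1 fi; apply/polyP => i; rewrite !(coef_red, coefZ) redM. Qed.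

Lemma red_polyX n f : int_poly f -> int_poly (f ^+ n) /\ red_poly red (f ^+ n) = red_poly red f ^+ n.
Proof.
move=> fi; elim: n => [|n [IH1 IH2]]; last by rewrite !exprS red_polyM ?IH2 //; split=> //; apply: int_polyM.
rewrite !expr0 -[1]/(1%:P) red_polyC red1; split=> //; apply: int_polyC.
by rewrite aval1.
Qed.

Lemma int_lin a b : v a <= 1 -> v b <= 1 -> int_poly (lin a b).
Proof. by move=> a1 b1 [|[|i]]; rewrite coef_lin ?aval0 ?ler01. Qed.

Lemma red_lin a b : red_poly red (lin a b) = lin (red a) (red b).
Proof. by apply/polyP => i; rewrite coef_red !coef_lin; case: i => [|[|i]] //; rewrite red0. Qed.

Lemma red_hcomp D f U V : int_poly f -> int_poly U -> int_poly V ->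
  int_poly (hcomp D f U V) /\
  red_poly red (hcomp D f U V) = hcomp D (red_poly red f) (red_poly red U) (red_poly red V).
Proof.
move=> fi Ui Vi; rewrite !hcompE.
have H (i : 'I_D.+1) : int_poly (f`_i *: (U ^+ i * V ^+ (D - i))).
  by apply: int_polyZ => //; apply: int_polyM; apply: (red_polyX _ _).1.
have [] : int_poly (\sum_(i < D.+1) f`_i *: (U ^+ i * V ^+ (D - i))) /\
    red_poly red (\sum_(i < D.+1) f`_i *: (U ^+ i * V ^+ (D - i))) =
    \sum_(i < D.+1) red_poly red (f`_i *: (U ^+ i * V ^+ (D - i))).
  elim/big_rec2: _ => [|i y x _ [xi E]].
    by rewrite -polyC0 red_polyC red0; split=> //; apply: int_polyC; rewrite aval0 ler01.
  by rewrite red_polyD // E; split=> //; apply: int_polyD.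
move=> si ->; split=> //; apply: eq_bigr => i _.
have Xi n := (red_polyX n Ui).1; have Yi n := (red_polyX n Vi).1.
rewrite red_polyZ //; last exact: int_polyM.
by rewrite red_polyM // (red_polyX _ Ui).2 (red_polyX _ Vi).2 coef_red.
Qed.

(** Two normalized representatives in lowest terms differ by a unit of the ring of integers,
so the value does not depend on the one that is chosen. *)
Lemma reductionE psi f g : psi != 0 -> coprimep f g -> psi = tofrac f / tofrac g ->
  int_poly f -> int_poly g -> (exists i, v f`_i = 1 \/ v g`_i = 1) ->
  reduction red psi = tofrac (red_poly red f) / tofrac (red_poly red g).
Proof.
move=> p0 cop E fi gi ex; rewrite /reduction.
have gN0 f' g' : psi = tofrac f' / tofrac g' -> g' != 0.
  by move=> E'; apply: contraNneq p0 => g0; rewrite E' g0 rmorph0 invr0 mulr0.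
have g0 := gN0 _ _ E.
case: xgetP => [tau -> [f' [g' [cop' E' fgi ex' ->]]]|
  /(_ (tofrac (red_poly red f) / tofrac (red_poly red g)))[]].
  have g'0 := gN0 _ _ E'.
  have [|u u0 [fE gE]] := lowest_terms_uniq g0 g'0 cop cop'; first by rewrite -E.
  have u1 : v u = 1.
    apply/le_anti/andP; split.
      by have [i [Hi|Hi]] := ex; have := fgi i; rewrite fE gE !coefZ !avalM Hi mulr1 => -[].
    case: ex' => i [] <-; rewrite ?fE ?gE coefZ avalM ler_piMr ?aval_ge0 //.
  rewrite gE fE !red_polyZ ?u1 // -!mul_polyC !rmorphM -mulf_div divff ?mul1r //.
  by rewrite tofrac_eq0 polyC_eq0 red_neq0.
by exists f, g; split.
Qed.

End Reduction.

Section ReductionConj.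
Variables (K : closedFieldType) (R : realType) (v : absval K R) (kappa : fieldType).
Variable red : residue_map v kappa.

Lemma hcomp_lin_pad (F : fieldType) D (a b : F) (U V : {poly F}) : (0 < D)%N ->
  hcomp D (lin a b) U V = V ^+ D.-1 * (a *: U + b *: V).
Proof.
case: D => // D _; rewrite hcompE big_ord_recl big_ord_recl big1 ?addr0 => [|i _]; last first.
  by rewrite coef_lin /= scale0r.
by rewrite !coef_lin /= !expr0 !expr1 mul1r subSS !subn0 -!mul_polyC [V ^+ D.+1]exprS; ring.
Qed.

(** In homogeneous coordinates the pair (f, g) reduces to Y^(D-1) times the linear pair
(f1 X + f0 Y, Y).  Composing with k and its inverse keeps this shape, and the common factor
cancels. *)
Lemma reduction_conj D f g h (k : 'M[K]_2) : (0 < D)%N -> is_lift D f g h ->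
  g`_0 = 1 -> (forall i, v g`_i.+1 < 1) -> v f`_0 <= 1 -> v f`_1 = 1 ->
  (forall i, v f`_i.+2 < 1) -> GL2O v k ->
  reduction red (ratconj h k) =
  mobius (map_mx red (invmx k) *m mx2 (red f`_1) (red f`_0) 0 1 *m map_mx red k).
Proof.
move=> D0 L g0 gs f0 f1 fs Gk; have k1 := GL2O_unit Gk.
set n := invmx k; have Gn : GL2O v n := GL2O_inv Gk; have n1 := GL2O_unit Gn.
have [ki dk] := Gk; have [ni dn] := Gn.
have L1 := lift_comp (ltn0Sn 0) L (mobius_lift k1); rewrite muln1 in L1.
have L2 := lift_comp D0 (mobius_lift n1) L1; rewrite mul1n in L2.
rewrite -/(ratconj h k) in L2.
have tr := lift_transc D0 L2.
have fi : int_poly v f by case=> [//|[|i]]; rewrite ?f1 // ltW.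
have gi : int_poly v g by case=> [|i]; rewrite ?g0 ?aval1 // ltW.
have redf : red_poly red f = lin (red f`_1) (red f`_0).
  apply/polyP => i; rewrite coef_red coef_lin; case: i => [|[|i]] //.
  exact: red_small.
have redg : red_poly red g = lin 0 1.
  apply/polyP => i; rewrite coef_red coef_lin; case: i => [|[|i]] //; rewrite ?g0 ?red1 //; exact: red_small.
set X := lin (k 0 0) (k 0 1) in L1 L2; set Y := lin (k 1 0) (k 1 1) in L1 L2.
have Xi : int_poly v X by apply: int_lin.
have Yi : int_poly v Y by apply: int_lin.
set U := hcomp D f X Y in L1 L2; set V := hcomp D g X Y in L1 L2.
have [Ui UE] := red_hcomp red D fi Xi Yi; have [Vi VE] := red_hcomp red D gi Xi Yi.
rewrite -/U -/V in Ui UE Vi VE.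
have nxi i : int_poly v (lin (n i 0) (n i 1)) by apply: int_lin.
have [Pi PE] := red_hcomp red 1 (nxi 0) Ui Vi.
have [Qi QE] := red_hcomp red 1 (nxi 1) Ui Vi.
set P := hcomp 1 _ U V in Pi PE L2; set Q := hcomp 1 _ U V in Qi QE L2.
have [_ cop Q0 EL] := L2.
set B := map_mx red n *m _ *m _.
have A1 : mx2 (red f`_1) (red f`_0) 0 1 \in unitmx.
  by rewrite unitmx2 !mx2E mulr1 mulr0 subr0 red_neq0.
have B1 : B \in unitmx by rewrite !unitmx_mul GL2O_red_unit //= A1 GL2O_red_unit.
set Yr := red_poly red Y.
have Yr0 : Yr != 0.
  rewrite /Yr red_lin lin_eq0; apply/negP => /andP[/eqP a /eqP b].
  by have := GL2O_red_unit red Gk; rewrite unitmx2 !mxE a b !mulr0 subr0 eqxx.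
have PE' : red_poly red P = Yr ^+ D.-1 * lin (B 0 0) (B 0 1).
  rewrite PE red_lin hcomp_lin UE VE redf redg !hcomp_lin_pad // !scalerAr -mulrDr; congr (_ * _).
  rewrite scale0r add0r scale1r /Yr !red_lin !lin_comb /B !mul_mx2 !mx2E !mxE.
  by congr lin; ring.
have QE' : red_poly red Q = Yr ^+ D.-1 * lin (B 1 0) (B 1 1).
  rewrite QE red_lin hcomp_lin UE VE redf redg !hcomp_lin_pad // !scalerAr -mulrDr; congr (_ * _).
  rewrite scale0r add0r scale1r /Yr !red_lin !lin_comb /B !mul_mx2 !mx2E !mxE.
  by congr lin; ring.
have redQ0 : red_poly red Q != 0.
  rewrite QE' mulf_neq0 ?expf_neq0 // lin_eq0; apply/negP => /andP[/eqP a /eqP b].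
  by move: B1; rewrite unitmx2 a b !mulr0 subr0 eqxx.
rewrite (@reductionE _ _ _ _ red _ P Q) //.
- rewrite PE' QE' !rmorphM -mulf_div divff ?mul1r //.
  by rewrite tofrac_eq0 expf_neq0.
- by have := @poly_at_neq0 _ _ tr 'X; rewrite poly_atX polyX_eq0; apply.
- apply: contrapT => H; case/negP: redQ0; apply/eqP/polyP => i; rewrite coef_red coef0.
  apply: red_small; rewrite lt_neqAle Qi andbT; apply/eqP => E.
  by apply: H; exists i; right.
Qed.
End ReductionConj.

(** * Tangent directions *)

(** A clopen part either meets A, hence contains it and its limit points, or is a
neighbourhood of p disjoint from A. *)
Lemma connected_add_limit (T : topologicalType) (A : set T) (p : T) :
  connected A -> closure A p -> connected (A `|` [set p]).
Proof.
move=> cA Ap B B0 [U oU BU] [C cC BC].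
have AB : A `&` B !=set0.
  case: B0 => b; have := congr1 (fun X => X b) BU; rewrite /= => Eb Bb.
  move: (Bb); rewrite Eb => -[[Ab|/= bp] Ub]; first by exists b.
  rewrite bp in Ub; have [x [Ax Ux]] := Ap U (open_nbhs_nbhs (conj oU Ub)).
  by exists x; split=> //; rewrite BU; split=> //; left.
have E : A `&` B = A.
  apply: cA => //.
    exists U => //; rewrite BU; apply/seteqP; split=> x /=; tauto.
  by exists C => //; rewrite BC; apply/seteqP; split=> x /=; tauto.
rewrite BC; apply/seteqP; split=> x; first by case.
move=> Hx; split=> //; case: Hx => [Ax|/= ->].
  by rewrite -E BC in Ax; case: Ax => _ [].
apply: (cC); apply: closureS Ap => y; rewrite -{1}E BC => -[_ []//].
Qed.

Section BerkTopology.
Variables (K : closedFieldType) (R : realType) (v : absval K R).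
Hypothesis v_nontrivial : av_nontrivial v.
Local Notation zpt := (disc_pt v_nontrivial).
Implicit Types (P : berkP1 v) (a b x y : K) (r t : R).

Lemma seminorm_of_continuous f : continuous (fun s : berkA1 v => seminorm_of s f).
Proof.
move=> s; apply: (@continuous_comp _ _ _ (set_val : berkA1 v -> {ptws {poly K} -> R})
  (fun g : {ptws {poly K} -> R} => g f)).
  exact: initial_continuous.
exact: (@proj_continuous _ (fun _ : {poly K} => R) f).
Qed.

(** Evaluation at f, extended to infinity by an arbitrary value so that limits can be taken
in the projective line. *)
Definition berk_eval f (x : berkP1 v) : R := if x is Some s then seminorm_of s f else 0.

Lemma berk_eval_cvg f s : {for (Some s : berkP1 v), continuous (berk_eval f)}.
Proof. by move=> U /seminorm_of_continuous. Qed.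

(** The topology is that of pointwise convergence, and the sup-norms of a fixed polynomial
are given by [disc_norm_prod]. *)
Lemma disc_pt_continuous a : continuous (fun t => Some (zpt a t) : berkP1 v).
Proof.
move=> t; apply: (@continuous_comp _ _ _ (zpt a) (Some : berkA1 v -> berkP1 v)); last first.
  exact: one_point_compactification_some_continuous.
move: t; apply: continuous_comp_initial => t.
apply/cvg_sup => f U [? /= [[W oW <-]] /= Wf /filterS]; apply.
  exact: (fmap_filter (set_val \o zpt a) (nbhs_filter t)).
have [s Ef _] := disc_norm_closed v_nontrivial a f (@ler01 R).
pose h (w : R) : R := v (lead_coef f) * \prod_(z <- s) Num.max w (v (a - z)).
have H (u : R) : disc_norm v a `|u| f = h `|u| by rewrite {1}Ef disc_norm_prod.
have hc : {for t, continuous (h \o (@Num.norm _ R))}.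
  by apply: continuous_comp; [exact: (@norm_continuous R R^o t)|exact: prod_max_continuous].
have Wt : W ((h \o (@Num.norm _ R)) t) by rewrite /= -H.
have := hc W (open_nbhs_nbhs (conj oW Wt)); move=> HW.
have : nbhs t ((h \o (@Num.norm _ R)) @^-1` W) by [].
by apply: (@filterS _ (nbhs t)) => u /=; rewrite -H.
Qed.

Lemma component_at_path P a t0 t1 : t0 <= t1 ->
  (forall t, t0 <= t <= t1 -> Some (zpt a t) <> P) ->
  component_at P (Some (zpt a t0)) = component_at P (Some (zpt a t1)).
Proof.
move=> t01 H; apply: same_connected_component.
apply: (@connected_component_max _ _ ((fun t => Some (zpt a t) : berkP1 v) @` `[t0, t1])).
- by exists t0 => //=; rewrite in_itv /= lexx.
- by move=> _ [t /= tin <-]; apply: H; rewrite in_itv /= in tin.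
- apply: connected_continuous_connected; first exact: segment_connected.
  by apply: continuous_subspaceT; apply: disc_pt_continuous.
by exists t1 => //=; rewrite in_itv /= lexx t01.
Qed.

(** Infinity is a limit of the points zeta_{a,t}: on a compact set the values at X - a
are bounded, while zeta_{a,t} takes the value t there. *)
Lemma component_at_infty P a : P <> berk_infty v ->
  (forall t, 0 <= t -> Some (zpt a t) <> P) ->
  component_at P (Some (zpt a 0)) = component_at P (berk_infty v).
Proof.
move=> Pinf H; pose A : set (berkP1 v) := (fun t => Some (zpt a t) : berkP1 v) @` `[0, +oo[.
have cA : connected A.
  apply: connected_continuous_connected; last first.
    by apply: continuous_subspaceT; apply: disc_pt_continuous.
  exact/connected_intervalP/interval_is_interval.
apply: same_connected_component.
apply: (@connected_component_max _ _ (A `|` [set berk_infty v])).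
- by left; exists 0 => //=; rewrite in_itv /= lexx.
- by move=> _ [[t /= tin <-]|/= ->]; [apply: H; move: tin; rewrite in_itv /= andbT|apply/nesym].
- apply: connected_add_limit => // U [C [cC _] CU].
  have bC : bounded_set ((fun s : berkA1 v => seminorm_of s ('X - a%:P)) @` C).
    apply: compact_bounded; apply: continuous_compact => //.
    by apply: continuous_subspaceT; apply: seminorm_of_continuous.
  have [M [Mr HM]] := bC.
  pose t := `|M| + 1.
  have t0 : 0 <= t by rewrite addr_ge0.
  exists (Some (zpt a t)); split; first by exists t => //=; rewrite in_itv /= t0.
  apply: CU; left; exists (zpt a t) => //= Ct.
  have := HM (`|M| + 1 / 2); rewrite ltr_pwDr ?ler_norm // => /(_ isT) /(_ t).
  rewrite /= ger0_norm // => HH; suff : t <= `|M| + 1 / 2 by rewrite /t; lra.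
  apply: HH; exists (zpt a t) => //; rewrite disc_ptE // disc_normXsubC // subrr aval0.
  by rewrite max_l.
by right.
Qed.

(** Follow the two paths zeta_{x,t} and zeta_{y,t} up to the radius |x - y|, where they meet;
neither goes through zeta_{a,r}. *)
Lemma component_finite a r x y : 0 < r ->
  (r < v (x - a) /\ r < v (y - a)) \/ v (x - y) < r ->
  component_at (zeta v a r) (typeI v (Some x)) = component_at (zeta v a r) (typeI v (Some y)).
Proof.
move=> r0 H; rewrite zetaE // !(typeIE v_nontrivial).
have xy0 : 0 <= v (x - y) := aval_ge0 _ _.
have meet : zpt x (v (x - y)) = zpt y (v (x - y)) by apply/disc_pt_eqE.
have avoid z : (r < v (z - a)) \/ v (x - y) < r ->
    forall t, 0 <= t <= v (x - y) -> Some (zpt z t) <> Some (zpt a r).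
  move=> Hz t /andP[t0 t1] /Some_inj/(disc_pt_eqE v_nontrivial _ _ t0 (ltW r0))[tr za].
  rewrite tr in t1 za; case: Hz; rewrite ltNge; first by rewrite za.
  by rewrite t1.
rewrite (@component_at_path _ x 0 (v (x - y))) //; last by apply: avoid; case: H => [[]|]; tauto.
rewrite meet -(@component_at_path _ y 0 (v (x - y))) //.
by apply: avoid; case: H => [[]|]; tauto.
Qed.

Lemma component_infinite a r x : 0 < r -> r < v (x - a) ->
  component_at (zeta v a r) (typeI v (Some x)) = component_at (zeta v a r) (berk_infty v).
Proof.
move=> r0 xa; rewrite zetaE // (typeIE v_nontrivial); apply: component_at_infty => //.
move=> t t0 /Some_inj/(disc_pt_eqE v_nontrivial _ _ t0 (ltW r0))[->].
by rewrite leNgt xa.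
Qed.

Section Directions.
Variables (kappa : fieldType) (red : residue_map v kappa).

Lemma affine_mx_eval c a (x : P1 K) : c != 0 ->
  rat_eval (mobius (affine_mx c a)) x = if x is Some z then Some (c * z + a) else None.
Proof.
move=> c0; rewrite -[x in LHS]hcoordK mobius_eval ?affine_mx_unit ?hcoord_neq0 //.
rewrite !mx2E mul0r add0r mul1r; case: x => [z|] /=.
  by rewrite /toP1 oner_eq0 divr1 mulr1.
by rewrite /toP1 eqxx.
Qed.

Lemma eq_red_P1 (x y : P1 K) : red_P1 red x = red_P1 red y ->
  let big (z : P1 K) := if z is Some w then 1 < v w else true in
  (big x /\ big y) \/ exists z w, [/\ x = Some z, y = Some w & v (z - w) < 1].
Proof.
case: x => [z|]; case: y => [w|] /=; last by left.
- case: leP => z1; case: leP => w1 //; last by left.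
  case=> E; right; exists z, w; split=> //; rewrite -(red_eq0 red) ?aval_add_le ?avalN //.
  suff -> : red (z - w) = 0 by [].
  by apply: (addIr (red w)); rewrite -redD ?aval_add_le ?avalN // subrK add0r.
- by case: leP => // z1 _; left.
- by case: leP => // w1 _; left.
Qed.

(** After scaling, two points with the same reduction are either both outside D(a,|c|), hence
in the direction of infinity, or at distance less than |c|. *)
Lemma component_affine_mx c a (x y : P1 K) : c != 0 -> red_P1 red x = red_P1 red y ->
  component_at (zeta v a (v c)) (typeI v (rat_eval (mobius (affine_mx c a)) x)) =
  component_at (zeta v a (v c)) (typeI v (rat_eval (mobius (affine_mx c a)) y)).
Proof.
move=> c0 /eq_red_P1 H; have vc : 0 < v c by rewrite aval_gt0.
have inf (z : P1 K) : (if z is Some w then 1 < v w else true) ->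
  component_at (zeta v a (v c)) (typeI v (rat_eval (mobius (affine_mx c a)) z)) =
  component_at (zeta v a (v c)) (berk_infty v).
  rewrite affine_mx_eval //; case: z => [z|//] z1; apply: component_infinite => //.
  by rewrite addrK avalM ltr_pMr.
case: H => [[/inf -> /inf ->//]|[z [w [-> -> zw]]]].
rewrite !affine_mx_eval //; apply: component_finite => //; right.
by rewrite opprD addrACA subrr addr0 -mulrBr avalM gtr_pMr.
Qed.

(** Compare g with the affine chart: the quotient stabilizes zeta_G, so it acts on reductions. *)
Lemma component_chart (g : 'M[K]_2) P (x y : P1 K) : is_typeII P -> g \in unitmx ->
  berk_act (mobius g) (zetaG v) = P ->
  red_P1 red (rat_eval (mobius (invmx g)) x) = red_P1 red (rat_eval (mobius (invmx g)) y) ->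
  component_at P (typeI v x) = component_at P (typeI v y).
Proof.
move=> [a [c [c0 ->]]] g1 gP E; have ga1 := affine_mx_unit a c0.
have k1 : invmx (affine_mx c a) *m g \in unitmx by rewrite unitmx_mul unitmx_inv ga1.
have st : berk_act (mobius (invmx (affine_mx c a) *m g)) (zetaG v) = zetaG v.
  rewrite berk_act_mobiusM ?unitmx_inv // gP -affine_mx_zetaG //.
  by rewrite -berk_act_mobiusM ?unitmx_inv // mulVmx // mobius1 zetaGE berk_act_id //; apply: disc_pt_norm.
have [u u0 Gk] := zetaG_stabilizer v_nontrivial k1 st.
have H (z : P1 K) : z = rat_eval (mobius (affine_mx c a))
    (rat_eval (mobius (u *: (invmx (affine_mx c a) *m g))) (rat_eval (mobius (invmx g)) z)).
  by rewrite mobius_scale // rat_eval_mobiusM ?unitmx_inv // !mobiusVK.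
rewrite [x in LHS]H [y in RHS]H; apply: component_affine_mx => //.
by rewrite !(red_mobius red _ Gk) E.
Qed.
End Directions.
End BerkTopology.

(** * Diameter, distance and fixed directions *)

Section Metric.
Variables (K : closedFieldType) (R : realType) (v : absval K R).
Hypothesis v_nontrivial : av_nontrivial v.
Local Notation zpt := (disc_pt v_nontrivial).
Implicit Types (P : berkP1 v) (a b c x y : K) (r t : R).

(** Evaluating at X - a_n and letting m tend to infinity in the nested discs gives
max(|c|, |b - a_n|) <= r_n.  Evaluating at X - b gives d <= |c|. *)
Lemma diam_disc_limit (a : nat -> K) (r : nat -> R) b c d : c != 0 ->
  (forall n, 0 < r n) ->
  (forall n, disc v (a n.+1) (r n.+1) `<=` disc v (a n) (r n)) ->
  (fun n => zeta v (a n) (r n)) @ \oo --> zeta v b (v c) -> r @ \oo --> d ->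
  d = v c /\ forall n, disc v b (v c) `<=` disc v (a n) (r n).
Proof.
move=> c0 r0 nest; rewrite zetaE ?aval_gt0 // => cz cr.
have ev e : (fun m => Num.max (r m) (v (a m - e))) @ \oo --> Num.max (v c) (v (b - e)).
  have := cvg_comp _ _ cz (@berk_eval_cvg _ _ v ('X - e%:P) (zpt b (v c))).
  rewrite /= disc_ptE ?aval_ge0 // disc_normXsubC ?aval_ge0 //.
  apply: cvg_trans; apply: near_eq_cvg; apply: nearW => m /=.
  by rewrite zetaE //= disc_ptE ?ltW // disc_normXsubC ?ltW.
have nestn n m : (n <= m)%N -> disc v (a m) (r m) `<=` disc v (a n) (r n).
  elim: m => [|m IH]; first by rewrite leqn0 => /eqP ->.
  by rewrite leq_eqVlt => /orP[/eqP->//|/IH H]; apply: subset_trans (nest m) H.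
have bound n : Num.max (v c) (v (b - a n)) <= r n.
  apply: (ler_cvg_to (ev (a n)) (cvg_cst (r n))).
  exists n => // m /= nm.
  rewrite -(disc_normXsubC v_nontrivial (a m) (a n) (ltW (r0 m))); apply: disc_norm_le; first exact: ltW.
  by move=> z /(nestn n m nm); rewrite !hornerE.
split.
  apply/le_anti/andP; split.
    have H := ev b; rewrite subrr aval0 [Num.max (v c) 0]max_l ?aval_ge0 // in H.
    by apply: (ler_cvg_to cr H); apply: nearW => m; rewrite le_max lexx.
  apply: (ler_cvg_to (cvg_cst (v c)) cr).
  by apply: nearW => n; apply: le_trans (bound n); rewrite le_max lexx.
move=> n z zb; have := bound n; rewrite ge_max => /andP[cn bn].
rewrite /disc /= -(subrKA b z (- a n)); apply: aval_add_le => //.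
exact: le_trans zb cn.
Qed.

Lemma disc_sub_unit b c : disc v b (v c) `<=` disc v 0 1 <-> v b <= 1 /\ v c <= 1.
Proof.
split=> [H|[b1 c1] z /= zb]; last first.
  by rewrite disc01 -(subrK b z); apply: aval_add_le => //; apply: le_trans c1.
have b1 : v b <= 1 by rewrite -disc01; apply: H; rewrite /disc /= subrr aval0 aval_ge0.
split=> //; rewrite -[c](addrK b); apply: aval_add_le; rewrite ?avalN // -disc01; apply: H.
by rewrite /disc /= addrK.
Qed.

(** The default value 0 is taken when the disc is not contained in the unit disc.  Since
log 0 = 0 by convention, it does no harm in the estimate of the distance. *)
Lemma diam_disc_zeta b c : c != 0 ->
  diam_disc (zeta v b (v c)) = 0 \/
  [/\ diam_disc (zeta v b (v c)) = v c, v b <= 1 & v c <= 1].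
Proof.
move=> c0; rewrite {1 2}/diam_disc; case: xgetP => [d -> [a [r [H nest cz cr]]]|]; last by left.
right; have [-> /(_ 0%N) sub] := diam_disc_limit c0 (fun n => (H n).1) nest cz cr.
have /disc_sub_unit[] : disc v b (v c) `<=` disc v 0 1 by apply: subset_trans sub (H 0%N).2.
by [].
Qed.

Lemma diam_disc_zetaG : diam_disc (zetaG v) = 1.
Proof.
rewrite /zetaG -(aval1 v); rewrite /diam_disc.
case: xgetP => [d -> [a [r [H nest cz cr]]]|/(_ (v 1))[]].
  by have [] := diam_disc_limit (oner_neq0 K) (fun n => (H n).1) nest cz cr.
exists (fun=> 0), (fun=> v 1); split=> //.
- by move=> n; rewrite aval_gt0 oner_neq0; split=> //; rewrite aval1.
- by move=> _; exact: subset_refl.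
- exact: cvg_cst.
- exact: cvg_cst.
Qed.

Lemma winv_zetaG : berk_act (tofrac 'X)^-1 (zetaG v) = zetaG v.
Proof.
rewrite -mobius_winv; apply: (GL2O_zetaG v_nontrivial); split=> [i j|].
  by case: (ord2P i) => ->; case: (ord2P j) => ->; rewrite mx2E ?aval0 ?aval1 ?ler01.
by rewrite det_mx2 mul0r mul1r sub0r avalN aval1.
Qed.

Lemma diam_zetaG : diam (zetaG v) = 1.
Proof. by rewrite /diam winv_zetaG diam_disc_zetaG; case: ifP. Qed.

(** The diameter is read off in the chart z or in the chart 1/z.  In either chart the same
bound will be proved, so it does not matter which chart the component of P selects. *)
Lemma diam_typeII P : is_typeII P ->
  diam P = 0 \/ exists b c, [/\ c != 0, v b <= 1, v c <= 1, diam P = v c &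
    P = berk_act (mobius (affine_mx c b)) (zetaG v) \/
    P = berk_act (mobius (winv K *m affine_mx c b)) (zetaG v)].
Proof.
move=> [a [c [c0 ->]]]; rewrite /diam; case: ifP => _; last first.
  have [->|[-> a1 c1]] := diam_disc_zeta a c0; [by left|right].
  by exists a, c; split=> //; left; rewrite (affine_mx_zetaG v_nontrivial).
have [b [c' [c'0 E]]] := winv_typeII v_nontrivial a c0.
rewrite E; have [->|[-> b1 c1]] := diam_disc_zeta b c'0; [by left|right].
exists b, c'; split=> //; right.
rewrite (berk_act_mobiusM v_nontrivial) ?winv_unit ?affine_mx_unit // (affine_mx_zetaG v_nontrivial) //.
rewrite -E mobius_winv -!mobius_winv -(affine_mx_zetaG v_nontrivial) //.
rewrite -!(berk_act_mobiusM v_nontrivial) ?unitmx_mul ?winv_unit ?affine_mx_unit //.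
by rewrite mulmxA winvK mul1mx.
Qed.

Lemma berk_path_refl (x : berkP1 v) : berk_path x x = [set x].
Proof.
apply/seteqP; split=> z; last by move=> /= ->; left.
case=> [[_ ->]//|[g [_ gi g0 g1 _]]].
have : (0 : R) = 1 by apply: gi; rewrite ?g0 ?g1 // in_itv /= lexx ler01.
by move/eqP; rewrite eq_sym oner_eq0.
Qed.

(** The path from zeta_G to itself is a single point, so the wedge is zeta_G or the default
value P. *)
Lemma wedge_zetaG P : berk_wedge P (zetaG v) = zetaG v \/ berk_wedge P (zetaG v) = P.
Proof.
rewrite /berk_wedge berk_path_refl; case: xgetP => [z -> [_ /= ->]|_]; first by left.
by right.
Qed.

(** In both cases of [wedge_zetaG] the distance is the logarithm of diam P up to sign. *)
Lemma rho_zetaG_le (q : R) P : rho q P (zetaG v) <= `|logb q (diam P)|.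
Proof.
rewrite /rho; have l1 : logb q 1 = 0 :> R by rewrite /logb ln1 mul0r.
have [->|->] := wedge_zetaG P; rewrite !diam_zetaG !l1.
  by rewrite mulr0 sub0r subr0 -normrN ler_norm.
by rewrite subr0 mulr2n mulrDl mul1r addrK ler_norm.
Qed.

Lemma typeI_neq_typeII P (a : P1 K) : is_typeII P -> typeI v a <> P.
Proof.
move=> [b [c [c0 ->]]]; rewrite zetaE ?aval_gt0 //; case: a => [a|//].
rewrite (typeIE v_nontrivial) => /Some_inj/(disc_pt_eqE v_nontrivial _ _ (lexx _) (aval_ge0 _ _))[E _].
by move/eqP: E; rewrite eq_sym aval_eq0 (negPf c0).
Qed.

(** An arc goes through P at most once, so from each of its other points one of the two ends
can be reached without crossing P. *)
Lemma fixed_direction psi P B : is_typeII P -> tangents P B ->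
  B `&` gamma_fix psi !=set0 ->
  exists2 a, rat_fixed psi a & B = component_at P (typeI v a).
Proof.
move=> tP [x xP ->] [z [Bz [a [b [fa fb path]]]]].
suff [e fe Be] : exists2 e, rat_fixed psi e & component_at P z (typeI v e).
  exists e => //.
  exact: etrans (same_connected_component Bz) (same_connected_component Be).
have zP : z <> P by have := connected_component_sub Bz.
case: path => [[_ ->]|[g [gc gi g0 g1 [t t01 gt]]]].
  exists a => //; apply: connected_component_refl; exact: typeI_neq_typeII.
have t01' : 0 <= t <= 1 by move: t01; rewrite in_itv.
have {t01'} [t0 t1] := andP t01'.
have sub s0 s1 e : 0 <= s0 -> s1 <= 1 -> s0 <= t <= s1 -> s0 <= e <= s1 ->
    (forall s, s0 <= s <= s1 -> g s <> P) -> component_at P z (g e).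
  move=> s00 s11 ts es avoid.
  apply: (@connected_component_max _ _ (g @` `[s0, s1])).
  - by exists t => //=; rewrite in_itv.
  - by move=> _ [s /= sin <-]; apply: avoid; rewrite in_itv in sin.
  - apply: connected_continuous_connected; first exact: segment_connected.
    apply: continuous_subspaceW gc => s /=; rewrite !in_itv /= => /andP[h1 h2].
    by rewrite (le_trans s00 h1) (le_trans h2 s11).
  by exists e => //=; rewrite in_itv.
have [[s s01 gs]|no] := pselect (exists2 s, s \in `[0, 1] & g s = P); last first.
  exists a => //; rewrite -g0; apply: (sub 0 1); rewrite ?lexx ?ler01 ?t0 //.
  by move=> s s01 gs; apply: no; exists s; rewrite // in_itv.
have uniq_s u : 0 <= u <= 1 -> g u = P -> u = s.
  by move=> u01 gu; apply: gi; rewrite ?in_itv // gu gs.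
have [ts|st|ts] := ltgtP t s.
- exists a => //; rewrite -g0; apply: (sub 0 t); rewrite ?lexx ?t0 ?t1 //.
  move=> u /andP[u0 ut] gu; have := uniq_s u _ gu; rewrite u0 (le_trans ut t1) => /(_ isT) E.
  by move: ts; rewrite -E ltNge ut.
- exists b => //; rewrite -g1; apply: (sub t 1); rewrite ?lexx ?t0 ?t1 //.
  move=> u /andP[ut u1] gu; have := uniq_s u _ gu; rewrite u1 (le_trans t0 ut) => /(_ isT) E.
  by move: st; rewrite -E ltNge ut.
- by case: zP; rewrite -gt ts.
Qed.

Lemma fset_set_gt2 (T : choiceType) (A : set T) : (2 < #|` fset_set A|)%N ->
  exists x y z : T, [/\ A x, A y & A z] /\ [/\ x <> y, x <> z & y <> z].
Proof.
have [fA|nA] := pselect (finite_set A); last first.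
  by rewrite /fset_set; case: pselect => // _; rewrite cardfs0.
have mem (u : T) : u \in enum_fset (fset_set A) -> A u.
  by move=> uA; apply: set_mem; rewrite -in_fset_set.
move: mem (fset_uniq (fset_set A)); rewrite /=.
case: (enum_fset _) => [|x [|y [|z s]]] //= mem.
rewrite !inE !negb_or => /and4P[/and3P[xy xz _] /andP[yz _] _ _] _.
exists x, y, z; split; split; try (by apply: mem; rewrite !inE eqxx ?orbT).
- exact/eqP.
- exact/eqP.
- exact/eqP.
Qed.
End Metric.

(** * Conjugation and maps that are Lipschitz for the chordal metric *)

Lemma invmxM (F : fieldType) n (A B : 'M[F]_n) : A \in unitmx -> B \in unitmx ->
  invmx (A *m B) = invmx B *m invmx A.
Proof.
move=> A1 B1; have AB : A *m B \in unitmx by rewrite unitmx_mul A1.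
apply: (can_inj (mulmxK AB)); rewrite mulVmx // -mulmxA (mulmxA _ A B) mulVmx // mul1mx.
by rewrite mulVmx.
Qed.

Section Conjugation.
Variables (K : closedFieldType) (R : realType) (v : absval K R).
Hypothesis v_nontrivial : av_nontrivial v.
Implicit Types (psi h : ratfun K) (A B k : 'M[K]_2) (x y : P1 K).

Lemma ratconj_lift D F G psi A : (0 < D)%N -> A \in unitmx -> is_lift D F G psi ->
  is_lift D
    (hcomp 1 (lin (invmx A 0 0) (invmx A 0 1))
      (hcomp D F (lin (A 0 0) (A 0 1)) (lin (A 1 0) (A 1 1)))
      (hcomp D G (lin (A 0 0) (A 0 1)) (lin (A 1 0) (A 1 1))))
    (hcomp 1 (lin (invmx A 1 0) (invmx A 1 1))
      (hcomp D F (lin (A 0 0) (A 0 1)) (lin (A 1 0) (A 1 1)))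
      (hcomp D G (lin (A 0 0) (A 0 1)) (lin (A 1 0) (A 1 1))))
    (ratconj psi A).
Proof.
move=> D0 A1 L; have L1 := lift_comp (ltn0Sn 0) L (mobius_lift A1); rewrite muln1 in L1.
have nA : invmx A \in unitmx by rewrite unitmx_inv.
by have := lift_comp D0 (mobius_lift nA) L1; rewrite mul1n.
Qed.

Lemma ratconj_eval D F G psi A x : (0 < D)%N -> A \in unitmx -> is_lift D F G psi ->
  rat_eval (ratconj psi A) x =
  rat_eval (mobius (invmx A)) (rat_eval psi (rat_eval (mobius A) x)).
Proof.
move=> D0 A1 L; have L1 := lift_comp (ltn0Sn 0) L (mobius_lift A1); rewrite muln1 in L1.
have nA : invmx A \in unitmx by rewrite unitmx_inv.
rewrite (rat_eval_comp x D0 (mobius_lift nA) L1).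
by rewrite (rat_eval_comp x (ltn0Sn 0) L (mobius_lift A1)).
Qed.

Lemma ratconjM psi A B : transcendental psi -> A \in unitmx -> B \in unitmx ->
  ratconj psi (A *m B) = ratconj (ratconj psi A) B.
Proof.
move=> tr A1 B1; have A1i : invmx A \in unitmx by rewrite unitmx_inv.
have B1i : invmx B \in unitmx by rewrite unitmx_inv.
rewrite /ratconj (invmxM A1 B1) -(ratcomp_mobius A1 B1) -(ratcomp_mobius B1i A1i).
move: (mobius_transc A1) (mobius_transc B1) (mobius_transc A1i).
move: (mobius A) (mobius B) (mobius (invmx A)) (mobius (invmx B)) => a b a' b' ta tb ta'.
have tQ := ratcomp_transc tr ta; have tX := ratcomp_transc tQ tb.
by rewrite (ratcompA psi ta tb) -(ratcompA b' ta' tX) -(ratcompA a' tQ tb).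
Qed.

Lemma ratconj_scale u psi A : u != 0 -> A \in unitmx -> ratconj psi (u *: A) = ratconj psi A.
Proof.
move=> u0 A1; rewrite /ratconj (mobius_scale _ u0) invmxZ ?unitmx_scale //.
by rewrite mobius_scale ?invr_eq0.
Qed.

Lemma ratconj_fixed psi A : transcendental psi -> A \in unitmx ->
  (berk_act psi (berk_act (mobius A) (zetaG v)) = berk_act (mobius A) (zetaG v)) <->
  (berk_act (ratconj psi A) (zetaG v) = zetaG v).
Proof.
move=> tr A1; have nG : is_norm (disc_pt v_nontrivial 0 1) by apply: disc_pt_norm.
have tA := mobius_transc A1; have nA : invmx A \in unitmx by rewrite unitmx_inv.
have tn := mobius_transc nA; rewrite (zetaGE v_nontrivial).
have [s [Es ns _]] := berk_act_norm nG tA.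
have [t [Et nt _]] := berk_act_norm ns tr.
have [w [Ew nw _]] := berk_act_norm nt tn.
have cancel B (n : berkA1 v) : B \in unitmx -> is_norm n ->
    berk_act (mobius (invmx B)) (berk_act (mobius B) (Some n)) = Some n.
  move=> B1 nn; rewrite -berk_act_comp //; try by apply: mobius_transc; rewrite ?unitmx_inv.
  by rewrite ratcomp_mobius ?unitmx_inv // mulVmx // mobius1 berk_act_id.
have -> : berk_act (ratconj psi A) (Some (disc_pt v_nontrivial 0 1)) = Some w.
  by rewrite /ratconj berk_act_comp ?berk_act_comp ?Es ?Et //; apply: ratcomp_transc.
rewrite Es Et; split=> [[ts]|wG].
  by rewrite -Ew ts -Es cancel.
by have := cancel _ t nA nt; rewrite invmxK Ew wG Es => ->.
Qed.

Lemma chordal_GL2O k x y : GL2O v k ->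
  chordal v (rat_eval (mobius k) x) (rat_eval (mobius k) y) = chordal v x y.
Proof.
move=> Gk; have k1 := GL2O_unit Gk.
have x0 := hcoord_neq0 x; have y0 := hcoord_neq0 y.
rewrite -[in LHS](hcoordK x) -[in LHS](hcoordK y) !mobius_eval //.
rewrite chordal_toP1 ?mobius_coord_neq0 // !GL2O_max_aval //.
rewrite -[in RHS](hcoordK x) -[in RHS](hcoordK y) chordal_toP1 //; congr (_ / _).
have [_ dk] := Gk; rewrite det2 in dk; rewrite -[RHS]mul1r -dk -avalM; congr (aval _ _); ring.
Qed.

Definition chordal_lipschitz (M : R) psi :=
  forall x y, chordal v (rat_eval psi x) (rat_eval psi y) <= M * chordal v x y.

Lemma chordal_lipschitz_conj D F G M psi k : (0 < D)%N -> is_lift D F G psi -> GL2O v k ->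
  chordal_lipschitz M psi -> chordal_lipschitz M (ratconj psi k).
Proof.
move=> D0 L Gk H x y; have k1 := GL2O_unit Gk.
rewrite !(ratconj_eval _ D0 k1 L) chordal_GL2O; last exact: GL2O_inv.
by rewrite -(chordal_GL2O x y Gk).
Qed.

End Conjugation.

(** * The local form of a Lipschitz map on a small disc *)

Section LocalForm.
Variables (K : closedFieldType) (R : realType) (v : absval K R).
Hypothesis v_nontrivial : av_nontrivial v.
Implicit Types (F G f g : {poly K}) (c x y z : K) (psi h : ratfun K).

(** Modulo the maximal ideal, g is 1 and f is affine. *)
Definition almost_affine f g :=
  [/\ g`_0 = 1, forall i, v g`_i.+1 < 1 & forall i, v f`_i.+2 < 1].

Lemma coef_hcomp_scale D F c i : (size F <= D.+1)%N ->
  (hcomp D F (lin c 0) (lin 0 1))`_i = c ^+ i * F`_i.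
Proof.
move=> sF; have one : lin 0 1 = 1 :> {poly K} by rewrite /lin scale0r add0r.
have X : lin c 0 = c *: 'X by rewrite /lin addr0.
rewrite hcompE one X coef_sum.
under eq_bigr => j _ do rewrite expr1n mulr1 exprZn !coefZ coefXn.
have [iD|Di] := ltnP i D.+1.
  rewrite (bigD1 (Ordinal iD)) //= eqxx mulr1 mulrC big1 ?addr0 // => j ji.
  by rewrite eq_sym; case: eqP => [E|]; rewrite ?mulr0 //; case/eqP: ji; apply/val_inj.
rewrite nth_default ?mulr0 ?(leq_trans sF) // big1 // => j _.
by case: eqP => [E|]; rewrite ?mulr0 //; have := ltn_ord j; rewrite -E ltnNge Di.
Qed.

Lemma horner_hcomp_scale D F c x : (size F <= D.+1)%N ->
  (hcomp D F (lin c 0) (lin 0 1)).[x] = F.[c * x].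
Proof.
by move=> sF; rewrite horner_hcomp /lin !hornerE ?(mul0r, addr0, add0r) heval_y1.
Qed.

Lemma inv_affine_mx c a : c != 0 -> invmx (affine_mx c a) = affine_mx c^-1 (- a / c).
Proof.
move=> c0; have A1 := affine_mx_unit a c0; apply: (can_inj (mulmxK A1)); rewrite mulVmx //.
by rewrite mul_mx2 !mx2E; apply: eq_mx2; rewrite !mxE /=; field.
Qed.

Lemma ratconj_diag_lift D F G psi c : (0 < D)%N -> c != 0 -> is_lift D F G psi ->
  is_lift D (c^-1 *: hcomp D F (lin c 0) (lin 0 1)) (hcomp D G (lin c 0) (lin 0 1))
    (ratconj psi (affine_mx c 0)).
Proof.
move=> D0 c0 L; have := ratconj_lift D0 (affine_mx_unit 0 c0) L.
rewrite inv_affine_mx // !hcomp_lin !mx2E oppr0 mul0r !scale0r scale1r addr0 add0r.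
by [].
Qed.

Lemma lift_scale D f g psi (u : K) : u != 0 -> is_lift D f g psi ->
  is_lift D (u *: f) (u *: g) psi.
Proof.
move=> u0 [[sf sg top] cop g0 E]; split.
- by rewrite !size_scale // !coefZ !mulf_eq0 (negPf u0); split.
- by rewrite coprimepZl // coprimepZr.
- by rewrite scaler_eq0 negb_or u0.
- by rewrite -!mul_polyC !rmorphM -mulf_div divff ?mul1r // tofrac_eq0 polyC_eq0.
Qed.

(** The points z with |F(z)| < |G(z)| are those mapped to the open unit disc.  A point of
that disc has chordal distance 1 from all points outside, while two points of the open disc
of radius 1/M are mapped to chordal distance less than 1. *)
Lemma small_value_spreads D F G psi M z0 z : is_lift D F G psi -> chordal_lipschitz v M psi -> 0 < M ->
  v z0 < M^-1 -> v z < M^-1 -> M^-1 <= 1 -> v F.[z0] < v G.[z0] -> v F.[z] < v G.[z].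
Proof.
move=> L H M0 z01 z1 M1 FG; have [[sF sG _] _ _ _] := L.
have E w : rat_eval psi (Some w) = toP1 F.[w] G.[w].
  by rewrite (lift_eval_hcoord _ L) /= !heval_y1.
have nz w : (F.[w] != 0) || (G.[w] != 0).
  by have := lift_heval_neq0 (x := w) (y := 1) L; rewrite !heval_y1 // oner_neq0 orbT; apply.
have := H (Some z) (Some z0); rewrite !E chordal_toP1 // => /le_lt_trans lt.
have {}lt := lt 1; have cz : M * chordal v (Some z) (Some z0) < 1.
  rewrite /chordal /= !mulr1 mul1r !aval1 !max_r ?mulr1 ?divr1 ?(le_trans (ltW z1)) ?(le_trans (ltW z01)) //.
  by rewrite mulrC -ltr_pdivlMr // mul1r aval_add_lt ?avalN.
have {lt cz} := lt cz; rewrite [Num.max (v F.[z0]) _]max_r ?(ltW FG) // => lt.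
rewrite ltNge; apply/negP => GF.
have G0 : 0 < v G.[z0] by apply: le_lt_trans FG; apply: aval_ge0.
have F0 : 0 < v F.[z].
  have := nz z; rewrite -!(aval_gt0 v) => /orP[//|gz]; exact: lt_le_trans gz GF.
rewrite max_l // in lt; move: lt; rewrite aval_add_dominant.
  by rewrite avalM divff ?ltxx // gt_eqF // mulr_gt0.
rewrite avalN !avalM; apply: (@le_lt_trans _ _ (v F.[z] * v F.[z0])).
  by rewrite ler_wpM2r ?aval_ge0.
by rewrite ltr_pM2l.
Qed.

(** For a root w outside the disc |z - w| = |w|. *)
Lemma aval_horner_const G (s : R) : 0 < s -> (forall z, v z <= s -> G.[z] != 0) ->
  forall z, v z <= s -> v G.[z] = v G.[0].
Proof.
move=> s0 H z zs; have [t E] := closed_field_poly_normal G.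
have l0 : lead_coef G != 0.
  by rewrite lead_coef_eq0; apply: contraNneq (H 0 _) => [->|]; rewrite ?horner0 ?aval0 // ltW.
rewrite E !aval_horner_prod; congr (_ * _); rewrite !big_seq; apply: eq_bigr => w wt.
rewrite sub0r avalN -avalN opprB aval_add_dominant ?avalN //; apply: le_lt_trans zs _.
rewrite ltNge; apply: contraTN isT => ws; have := H w ws; rewrite E hornerZ mulf_eq0 negb_or l0 /=.
by rewrite -/(root _ w) root_prod_XsubC wt.
Qed.

(** The map has no pole and values of absolute value less than 1 on the disc of radius s,
which gives Cauchy estimates for F and G; rescaling by c makes them strict. *)
Lemma local_form D F G psi M c z0 : (0 < D)%N -> is_lift D F G psi -> chordal_lipschitz v M psi ->
  1 < M -> c != 0 -> v c * M ^+ 2 < 1 -> v z0 <= v c -> v F.[z0] < v G.[z0] ->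
  exists f g, is_lift D f g (ratconj psi (affine_mx c 0)) /\ almost_affine f g.
Proof.
move=> D0 L H M1 c0 cM z0c FG; have M0 : 0 < M by apply: lt_trans M1.
have vc : 0 < v c by rewrite aval_gt0.
have M1' : M^-1 <= 1 by rewrite invf_le1 // ltW.
(* On the radius s the Cauchy estimates give |F_i|, |G_i| <= |u| s^-i; the rescaled
   coefficients of degree at least 2 of F carry a factor |c|^(i-1), and s^2 > |c| is
   what makes |c|^(i-1) s^-i < 1 from i = 2 on. *)
pose s0 := Num.sqrt (v c); have s0E : s0 ^+ 2 = v c by rewrite sqr_sqrtr ?aval_ge0.
have s0p : 0 < s0 by rewrite sqrtr_gt0.
have s0M : s0 < M^-1.
  rewrite -[M^-1]mul1r ltr_pdivlMr // -(@ltr_pXn2r _ 2) ?nnegrE ?mulr_ge0 ?ltW //.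
  by rewrite exprMn s0E expr1n.
pose s := (s0 + M^-1) / 2; have ss0 : s0 < s by rewrite /s; lra.
have sM : s < M^-1 by rewrite /s; lra.
have sp : 0 < s by apply: lt_trans ss0.
have s1 : s < 1 by apply: lt_le_trans M1'.
have cs2 : v c < s ^+ 2 by rewrite -s0E ltr_pXn2r // nnegrE ltW.
have cs : v c < s by apply: lt_trans cs2 _; rewrite expr2 gtr_pMl.
have small z : v z <= s -> v F.[z] < v G.[z].
  move=> zs; apply: (small_value_spreads L H M0 _ _ M1' FG); last exact: le_lt_trans sM.
  by apply: le_lt_trans z0c _; apply: lt_trans sM.
have Gconst z : v z <= s -> v G.[z] = v G.[0].
  apply: aval_horner_const => // w ws; rewrite -(aval_gt0 v); apply: le_lt_trans (small w ws).
  exact: aval_ge0.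
pose u := G.[0]; have u0 : u != 0.
  by rewrite -(aval_gt0 v); apply: le_lt_trans (small 0 _); rewrite ?aval_ge0 // aval0 ltW.
have vu : 0 < v u by rewrite aval_gt0.
have bound (P : {poly K}) i : (forall z, v z <= s -> v P.[z] <= v u) -> v P`_i * s ^+ i <= v u.
  move=> HP; apply: le_trans (disc_norm_coef v_nontrivial P i (ltW sp)) _.
  apply: disc_norm_le => //; first exact: ltW.
  by move=> z; rewrite /disc /= subr0; apply: HP.
have Gb i : v G`_i * s ^+ i <= v u by apply: bound => z /Gconst ->.
have Fb i : v F`_i * s ^+ i <= v u.
  by apply: bound => z zs; rewrite -(Gconst z zs) ltW ?small.
have [[sF sG _] _ _ _] := L.
have L' := lift_scale (_ : u^-1 != 0) (ratconj_diag_lift D0 c0 L).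
do 2 eexists; split; first by apply: L'; rewrite invr_eq0.
have est (P : {poly K}) i (m : R) : v P`_i * s ^+ i <= v u -> 0 < m -> m < s ^+ i ->
    v P`_i * m < v u.
  move=> Pb m0 ms; have [->|P0] := eqVneq P`_i 0; first by rewrite aval0 mul0r.
  by apply: lt_le_trans Pb; rewrite ltr_pM2l // aval_gt0.
split=> [|i|i]; rewrite !coefZ.
- by rewrite coef_hcomp_scale // expr0 mul1r -horner_coef0 mulVf.
- rewrite coef_hcomp_scale // !avalM avalV mulrC ltr_pdivrMr // mul1r mulrC avalX est ?exprn_gt0 //.
  by rewrite ltr_pXn2r ?nnegrE ?ltW.
- rewrite coef_hcomp_scale // exprS -mulrA mulKf // !avalM avalV avalX mulrC.
  rewrite ltr_pdivrMr // mul1r mulrC est ?exprn_gt0 // exprS.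
  apply: (@lt_le_trans _ _ (s ^+ 2 * v c ^+ i)); first by rewrite ltr_pM2r ?exprn_gt0.
  rewrite (exprD s 2 i) ler_pM2l ?exprn_gt0 //.
  by rewrite lerXn2r ?nnegrE ?ltW.
Qed.

End LocalForm.

(** * Almost affine maps and the vanishing of the weight *)

Section AlmostAffine.
Variables (K : closedFieldType) (R : realType) (v : absval K R).
Hypothesis v_nontrivial : av_nontrivial v.
Variables (D : nat) (f g : {poly K}) (h : ratfun K).
Hypotheses (D0 : (0 < D)%N) (L : is_lift D f g h) (aff_fg : almost_affine v f g).
Implicit Types (c x y z e : K).

Lemma gauss_den : disc_norm v 0 1 g = 1.
Proof.
have [g0 gs _] := aff_fg; apply/le_anti/andP; split.
  by apply: gauss_le => // -[|i]; rewrite ?g0 ?aval1 // ltW.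
by have := gauss_coef v_nontrivial g 0; rewrite g0 aval1.
Qed.

Lemma zetaG_fixedE : berk_act h (zetaG v) = zetaG v <->
  forall e, disc_norm v 0 1 (f - e *: g) = Num.max 1 (v e).
Proof.
have [_ _ g0 E] := L; have tr := lift_transc D0 L; rewrite (zetaGE v_nontrivial).
rewrite (berk_act_frac _ (disc_pt_norm v_nontrivial 0 ltr01) tr g0 E).
by split=> H e; have := H e;
  rewrite !disc_ptE // gauss_den mul1r disc_normXsubC // sub0r avalN.
Qed.

(** The value at X - f0 of the image of zeta_G is the Gauss norm of f - f0 g, a polynomial
without constant term.  Its coefficients of degree at least 2 are less than 1 in absolute
value, and that of degree 1 differs from f1 by such an element. *)
Lemma fixed_zetaG_coef : berk_act h (zetaG v) = zetaG v -> v f`_0 <= 1 /\ v f`_1 = 1.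
Proof.
move=> /zetaG_fixedE H; have [g0 gs fs] := aff_fg.
have f1 i : v f`_i <= 1.
  apply: le_trans (gauss_coef v_nontrivial f i) _.
  by have := H 0; rewrite scale0r subr0 aval0 max_l // => ->.
split=> //; apply/le_anti; rewrite f1 /= leNgt; apply/negP => lt.
have : disc_norm v 0 1 (f - f`_0 *: g) < 1.
  apply: gauss_lt1 => -[|i]; rewrite coefB coefZ ?g0 ?mulr1 ?subrr ?aval0 //.
  apply: aval_add_lt; first by case: i => [|i].
  by rewrite avalN avalM; apply: le_lt_trans (gs i); rewrite ler_piMl ?aval_ge0.
by rewrite H max_l // ltxx.
Qed.

Lemma coef_fixed_zetaG : v f`_0 <= 1 -> v f`_1 = 1 -> berk_act h (zetaG v) = zetaG v.
Proof.
move=> f0 f1; apply/zetaG_fixedE => e; have [g0 gs fs] := aff_fg.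
have fi i : v f`_i <= 1 by case: i => [//|[|i]]; rewrite ?f1 // ltW.
have gi i : v g`_i <= 1 by case: i => [|i]; rewrite ?g0 ?aval1 // ltW.
apply/le_anti/andP; split.
  apply: gauss_le => // [|i]; first by rewrite le_max ler01.
  rewrite coefB coefZ; apply: aval_add_le; rewrite le_max ?fi // avalN avalM.
  by rewrite ler_piMr ?aval_ge0 ?orbT.
have [e1|e1] := leP (v e) 1.
  apply: le_trans (gauss_coef v_nontrivial _ 1); rewrite coefB coefZ aval_add_dominant f1 // avalN avalM.
  by apply: le_lt_trans (gs 0%N); rewrite ler_piMl ?aval_ge0.
apply: le_trans (gauss_coef v_nontrivial _ 0); rewrite coefB coefZ g0 mulr1.
by rewrite aval_subC aval_add_dominant // avalN; apply: le_lt_trans e1.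
Qed.

(** The equation f(y) = y g(y), where all the small coefficients are collected in r. *)
Lemma fixed_point_eq y : v y <= 1 -> rat_eval h (Some y) = Some y ->
  exists2 r, v r < 1 & f`_0 + (f`_1 - 1) * y = r.
Proof.
move=> y1 fy; have [g0 gs fs] := aff_fg; have [[sf sg _] _ _ _] := L.
pose r := f - (f`_0)%:P - f`_1 *: 'X - 'X * (g - 1).
have rs : v r.[y] < 1.
  apply: le_lt_trans (_ : disc_norm v 0 1 r < 1).
    by apply: aval_le_disc_norm; rewrite // disc01.
  apply: gauss_lt1 => i.
  rewrite /r !coefB coefXM coefB coefC coefZ coefX coef1; case: i => [|[|i]] /=.
  - by rewrite mulr0 !subr0 subrr aval0.
  - by rewrite g0 mulr1 subrr !subr0 subrr aval0.
  - by rewrite mulr0 !subr0 aval_add_lt ?avalN.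
exists (- r.[y]); first by rewrite avalN.
have eqy : f.[y] = y * g.[y].
  move: fy; rewrite (lift_eval_hcoord _ L) /= !heval_y1 // /toP1; case: eqP => // /eqP gy [E].
  by rewrite -{2}E divfK.
rewrite /r !hornerE eqy; ring.
Qed.

(** Subtracting the two equations leaves (f1 - 1)(y1 - y2) = r1 - r2. *)
Lemma two_fixed_points_coef y1 y2 : v y1 <= 1 -> v y2 <= 1 -> v (y1 - y2) = 1 ->
  rat_eval h (Some y1) = Some y1 -> rat_eval h (Some y2) = Some y2 ->
  v f`_0 <= 1 /\ v f`_1 = 1.
Proof.
move=> v1 v2 v12 /(fixed_point_eq v1)[r1 r1s E1] /(fixed_point_eq v2)[r2 r2s E2].
have lt : v (f`_1 - 1) < 1.
  have -> : v (f`_1 - 1) = v ((f`_1 - 1) * (y1 - y2)) by rewrite avalM v12 mulr1.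
  have -> : (f`_1 - 1) * (y1 - y2) = r1 - r2 by rewrite -E1 -E2; ring.
  by apply: aval_add_lt; rewrite ?avalN.
split.
  have -> : f`_0 = r1 - (f`_1 - 1) * y1 by rewrite -E1; ring.
  apply: aval_add_le; first exact: ltW.
  by rewrite avalN avalM_le1 // ltW.
by rewrite -(subrK 1 f`_1) addrC aval_add_dominant aval1.
Qed.

End AlmostAffine.

Section WeightVanishes.
Variables (K : closedFieldType) (R : realType) (v : absval K R).
Hypothesis v_nontrivial : av_nontrivial v.
Variables (kappa : fieldType) (red : residue_map v kappa).
Implicit Types (psi h : ratfun K) (P : berkP1 v) (c : K) (k : 'M[K]_2).

Lemma red_fixed_point D f g h (x : P1 K) : (0 < D)%N -> is_lift D f g h ->
  almost_affine v f g -> v f`_0 <= 1 -> v f`_1 = 1 -> rat_eval h x = x ->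
  rat_eval (mobius (mx2 (red f`_1) (red f`_0) 0 1)) (red_P1 red x) = red_P1 red x.
Proof.
move=> D0 L AA f0 f1 hx.
have A1 : mx2 (red f`_1) (red f`_0) 0 1 \in unitmx.
  by rewrite unitmx2 !mx2E mulr1 mulr0 subr0 red_neq0.
rewrite -[in LHS](hcoordK (red_P1 red x)) mobius_eval ?hcoord_neq0 // !mx2E.
case: x hx => [x|] hx /=; last by rewrite /toP1 mul0r mul1r add0r eqxx.
case: ifP => x1 /=; last by rewrite /toP1 mul0r mul1r add0r eqxx.
rewrite mul0r add0r !mulr1 /toP1 oner_eq0 divr1; congr Some.
have [r r1 E] := fixed_point_eq v_nontrivial L AA x1 hx.
rewrite -redM ?f1 // -redD ?avalM_le1 ?f1 //.
have -> : f`_1 * x + f`_0 = x + r by rewrite -E; ring.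
by rewrite redD ?(ltW r1) // (red_small red r1) addr0.
Qed.

Lemma chart_spec P : is_typeII P ->
  chart P \in unitmx /\ berk_act (mobius (chart P)) (zetaG v) = P.
Proof.
move=> [a [c [c0 ->]]]; rewrite /chart; case: xgetP => [M -> //|/(_ (affine_mx c a))[]].
by split; [exact: affine_mx_unit|exact: affine_mx_zetaG].
Qed.

(** Evaluating at X shows that the Gauss norm of F(cz) is |c| < 1 times that of G(cz). *)
Lemma fixed_zetaG_small_value D F G psi c : (0 < D)%N -> is_lift D F G psi -> c != 0 -> v c < 1 ->
  berk_act (ratconj psi (affine_mx c 0)) (zetaG v) = zetaG v ->
  exists2 z, v z <= v c & v F.[z] < v G.[z].
Proof.
move=> D0 L c0 c1; have L1 := ratconj_diag_lift D0 c0 L; have tr := lift_transc D0 L1.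
have [[sF sG _] _ _ _] := L; have [_ _ V0 E] := L1.
set U := _ *: _ in L1 E; set V := hcomp _ _ _ _ in L1 E V0.
have nG := disc_pt_norm v_nontrivial 0 (@ltr01 R).
rewrite (zetaGE v_nontrivial) (berk_act_frac _ nG tr V0 E) => /(_ 0).
rewrite scale0r subr0 !disc_ptE // disc_normXsubC // subrr aval0 max_l // mulr1 => UV.
apply: contrapT => no.
have le z : v z <= v c -> v G.[z] <= v F.[z].
  by move=> zc; rewrite leNgt; apply/negP => H; apply: no; exists z.
have gV : 0 < disc_norm v 0 1 V by rewrite lt_neqAle eq_sym disc_norm_neq0 // disc_norm_ge0.
suff : disc_norm v 0 1 V <= v c * disc_norm v 0 1 V.
  by rewrite leNgt gtr_pMl // c1.
apply: disc_norm_le => // w; rewrite disc01 => w1.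
apply: (@le_trans _ _ (v c * v U.[w])).
  rewrite /U hornerZ !horner_hcomp_scale // avalM mulrA -avalM divff // aval1 mul1r.
  by apply: le; rewrite avalM ler_piMr ?aval_ge0.
by rewrite ler_wpM2l ?aval_ge0 // -UV aval_le_disc_norm // disc01.
Qed.

(** At the fixed point y of the rescaled map, F(cy)/G(cy) = cy. *)
Lemma fixed_point_small_value D F G psi c (y : K) : (0 < D)%N -> is_lift D F G psi ->
  c != 0 -> v c < 1 -> v y <= 1 -> rat_eval (ratconj psi (affine_mx c 0)) (Some y) = Some y ->
  exists2 z, v z <= v c & v F.[z] < v G.[z].
Proof.
move=> D0 L c0 c1 y1; have L1 := ratconj_diag_lift D0 c0 L.
have [[sF sG _] _ _ _] := L; have [[sU sV _] _ _ _] := L1.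
rewrite (lift_eval_hcoord _ L1) /= !heval_y1 // hornerZ !horner_hcomp_scale //.
rewrite /toP1; case: eqP => // /eqP G0 [E].
exists (c * y); first by rewrite avalM ler_piMr ?aval_ge0.
have -> : F.[c * y] = c * y * G.[c * y].
  by rewrite -{2}E mulrA divfK // mulrA divff ?mul1r.
rewrite !avalM gtr_pMl ?aval_gt0 //; apply: le_lt_trans c1.
by rewrite ler_piMr ?aval_ge0.
Qed.

Lemma weight_eq0 D F G psi (M : R) k c P : (0 < D)%N -> is_lift D F G psi -> chordal_lipschitz v M psi ->
  1 < M -> GL2O v k -> c != 0 -> v c * M ^+ 2 < 1 -> is_typeII P ->
  P = berk_act (mobius (k *m affine_mx c 0)) (zetaG v) -> weight red psi P = 0%N.
Proof.
move=> D0 L lip M1 Gk c0 cM tP PE.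
have k1 := GL2O_unit Gk; have a1 := affine_mx_unit 0 c0.
set g0 := k *m affine_mx c 0 in PE; have g01 : g0 \in unitmx by rewrite unitmx_mul k1.
have tr := lift_transc D0 L.
have L' := ratconj_lift D0 k1 L; set psi' := ratconj psi k in L'.
have lip' : chordal_lipschitz v M psi' := chordal_lipschitz_conj D0 L Gk lip.
have hE : ratconj psi g0 = ratconj psi' (affine_mx c 0) := ratconjM tr k1 a1.
set h := ratconj psi' (affine_mx c 0) in hE.
have vc1 : v c < 1.
  apply: le_lt_trans cM; rewrite ler_peMr ?aval_ge0 // exprn_ege1 //.
  exact: ltW.
have fixE : berk_act psi P = P <-> berk_act h (zetaG v) = zetaG v.
  by rewrite PE -hE; apply: ratconj_fixed.
rewrite /weight (asboolT tP); case: eqP => [/fixE fixG|nfix].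
(* P fixed: the chart of P that was chosen differs from g0 by k2. *)
- have [z0 z0c FG] := fixed_zetaG_small_value D0 L' c0 vc1 fixG.
  have [f [g [Lh AA]]] := local_form v_nontrivial D0 L' lip' M1 c0 cM z0c FG.
  have [f0 f1] := fixed_zetaG_coef v_nontrivial D0 Lh AA fixG.
  have [ch1 chP] := chart_spec tP; set ch := chart P in ch1 chP *.
  have g0i : invmx g0 \in unitmx by rewrite unitmx_inv.
  have k21 : invmx g0 *m ch \in unitmx by rewrite unitmx_mul g0i.
  have st : berk_act (mobius (invmx g0 *m ch)) (zetaG v) = zetaG v.
    rewrite (berk_act_mobiusM v_nontrivial) // chP PE -(berk_act_mobiusM v_nontrivial) //.
    rewrite mulVmx // mobius1 (zetaGE v_nontrivial) berk_act_id //.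
    exact: disc_pt_norm.
  have [u u0 Gu] := zetaG_stabilizer v_nontrivial k21 st; set k2 := u *: _ in Gu.
  have k2u := GL2O_unit Gu.
  have conjE : ratconj psi ch = ratconj h k2.
    rewrite /k2 ratconj_scale // -hE -ratconjM // mulmxA mulmxV // mul1mx //.
  have [g00 gs fs] := AA.
  have redE := reduction_conj red D0 Lh g00 gs f0 f1 fs Gu.
  rewrite -conjE in redE; set B := _ *m _ *m _ in redE.
  have A1 : mx2 (red f`_1) (red f`_0) 0 1 \in unitmx.
    by rewrite unitmx2 !mx2E mulr1 mulr0 subr0 red_neq0.
  have n1 := GL2O_red_unit red (GL2O_inv Gu); have r1 := GL2O_red_unit red Gu.
  have B1 : B \in unitmx by rewrite !unitmx_mul n1 A1 r1.
  rewrite /deg_at /reduction_at -/ch redE (lift_ratdeg (mobius_lift B1)) subnn add0n.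
  suff -> : shearing red psi P = set0 by rewrite fset_set0 cardfs0.
  (* A direction that contains a fixed point a is fixed: a is read in the chart as y, and
     the reduction of y is fixed because it is that of a fixed point of h, moved by k2. *)
  apply/seteqP; split=> // S [tS [a fa Sa] []]; split=> //.
  have ay : rat_eval (mobius ch) (rat_eval (mobius (invmx ch)) a) = a by rewrite mobiusVK.
  set y := rat_eval (mobius (invmx ch)) a in ay.
  exists (red_P1 red y); exists y; rewrite -/ch ?ay //.
  rewrite /reduction_at -/ch redE /B !rat_eval_mobiusM ?unitmx_mul ?n1 ?A1 //.
  rewrite -(red_mobius red y Gu).
  have yE : rat_eval (mobius k2) y = rat_eval (mobius (invmx g0)) a.
    by rewrite /k2 mobius_scale // rat_eval_mobiusM // ay.
  rewrite (red_fixed_point D0 Lh AA f0 f1).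
    by rewrite -(red_mobius red _ (GL2O_inv Gu)) mobiusK.
  by rewrite yE -/h -hE (ratconj_eval _ D0 g01 L) mobiusVK // fa.
(* P not fixed: of three directions at P, at least two have a finite reduction. *)
- apply/eqP; rewrite subn_eq0 leqNgt; apply/negP; rewrite /valence_fix.
  case: ifP => // _ /fset_set_gt2[B1 [B2 [B3 [[H1 H2 H3] [n12 n13 n23]]]]].
  apply: nfix; apply/fixE.
  have dir B : (tangents P `&` [set B | B `&` gamma_fix psi !=set0]) B ->
      exists2 y, rat_eval h y = y & B = component_at P (typeI v (rat_eval (mobius g0) y)).
    move=> [tB Bg]; have [a fa ->] := fixed_direction v_nontrivial tP tB Bg.
    exists (rat_eval (mobius (invmx g0)) a); last by rewrite mobiusVK.
    by rewrite -hE (ratconj_eval _ D0 g01 L) mobiusVK // fa.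
  have [y1 fy1 E1] := dir _ H1; have [y2 fy2 E2] := dir _ H2; have [y3 fy3 E3] := dir _ H3.
  have sep x y : component_at P (typeI v (rat_eval (mobius g0) x)) <>
      component_at P (typeI v (rat_eval (mobius g0) y)) -> red_P1 red x <> red_P1 red y.
    move=> ne E; apply: ne; apply: (component_chart v_nontrivial (red := red) tP g01) => //.
    by rewrite !mobiusK.
  have key x y : rat_eval h x = x -> rat_eval h y = y -> red_P1 red x <> red_P1 red y ->
      red_P1 red x <> None -> red_P1 red y <> None -> berk_act h (zetaG v) = zetaG v.
    case: x => [x|//]; case: y => [y|//] /= fx fy.
    case: ifP => // xO; case: ifP => // yO xy _ _.
    have [z0 z0c FG] := fixed_point_small_value D0 L' c0 vc1 xO fx.
    have [f [g [Lh AA]]] := local_form v_nontrivial D0 L' lip' M1 c0 cM z0c FG.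
    have xy1 : v (x - y) = 1.
      apply/le_anti; rewrite aval_add_le ?avalN //= leNgt; apply/negP => lt; apply: xy.
      by rewrite -(subrK y x) redD ?(red_small red lt) ?add0r // ltW.
    have [f0 f1] := two_fixed_points_coef v_nontrivial Lh AA xO yO xy1 fx fy.
    exact: coef_fixed_zetaG Lh AA f0 f1.
  rewrite E1 E2 in n12; rewrite E1 E3 in n13; rewrite E2 E3 in n23.
  have {}n12 := sep _ _ n12; have {}n13 := sep _ _ n13; have {}n23 := sep _ _ n23.
  have [r1|r1] := pselect (red_P1 red y1 = None).
    by apply: (key y2 y3) => // r; [apply: n12|apply: n13]; rewrite r1 r.
  have [r2|r2] := pselect (red_P1 red y2 = None).
    by apply: (key y1 y3) => // r; apply: n23; rewrite r2 r.
  exact: (key y1 y2).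
Qed.

End WeightVanishes.

(** * The Lipschitz constant of the iterates *)

Section Lipschitz.
Variables (K : closedFieldType) (R : realType) (v : absval K R).
Implicit Types (phi : ratfun K).

Lemma chordal_gt0 (x y : P1 K) : x <> y -> 0 < chordal v x y.
Proof.
have Hx := hcoord_neq0 x; have Hy := hcoord_neq0 y.
move=> ne; rewrite -(hcoordK x) -(hcoordK y) chordal_toP1 //.
rewrite divr_gt0 ?mulr_gt0 ?max_aval_gt0 // aval_gt0 subr_eq0; apply/negP => /eqP E.
apply: ne; rewrite -(hcoordK x) -(hcoordK y); apply: toP1_eq => //.
by rewrite E mulrC.
Qed.

Lemma chordal_le1 (x y : P1 K) : chordal v x y <= 1.
Proof.
have [a [b [ab ->]]] := primitive_coord v x; have [a' [b' [ab' ->]]] := primitive_coord v y.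
have nz c d : Num.max (v c) (v d) = 1 -> (c != 0) || (d != 0).
  by move=> cd; rewrite -!(aval_gt0 v) -lt_max cd ltr01.
have le c d : Num.max (v c) (v d) = 1 -> v c <= 1 /\ v d <= 1.
  by move=> <-; rewrite !le_max !lexx orbT.
have [[a1 b1] [a'1 b'1]] := (le _ _ ab, le _ _ ab').
rewrite chordal_toP1 ?nz // ab ab' mul1r divr1.
by apply: aval_add_le; rewrite ?avalN avalM_le1.
Qed.

(** A form of positive degree has a zero on the projective line. *)
Lemma lift_preimage D f g phi (z : P1 K) : (0 < D)%N -> is_lift D f g phi ->
  z = Some 0 \/ z = None -> exists x, rat_eval phi x = z.
Proof.
move=> D0 L Hz; have [[sf sg _] _ _ _] := L.
have zero (p : {poly K}) : (size p <= D.+1)%N ->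
    exists x : P1 K, heval D p (hcoord x).1 (hcoord x).2 = 0.
  move=> sp; have [s1|s1] := eqVneq (size p) 1%N.
    exists None; rewrite /= heval_y0 nth_default ?mul0r // s1.
    by [].
  have /closed_rootP[x /eqP px] := s1.
  by exists (Some x); rewrite /= heval_y1.
case: Hz => ->; [have [x px] := zero f sf|have [x px] := zero g sg]; exists x;
  have := lift_heval_neq0 L (hcoord_neq0 x); rewrite (lift_eval_hcoord _ L) px eqxx /=.
  by move=> q0; rewrite /toP1 (negPf q0) mul0r.
by rewrite /toP1 eqxx.
Qed.

(** That Lt > 1 follows from surjectivity: preimages of 0 and infinity have chordal distance
at most 1, and their images have distance 1. *)
Lemma lipschitz_const_lt phi (Lt : R) : (0 < ratdeg phi)%N ->
  (lipschitz_const v phi < Lt%:E)%E -> 1 < Lt /\ chordal_lipschitz v Lt phi.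
Proof.
move=> d0 lt; have L := lift_rnum phi.
have ratio (x y : P1 K) : x <> y ->
    chordal v (rat_eval phi x) (rat_eval phi y) / chordal v x y < Lt.
  move=> xy; rewrite -lte_fin; apply: le_lt_trans lt.
  by apply: ereal_sup_ubound; exists x, y.
have c00 (x : P1 K) : chordal v x x = 0.
  by rewrite -(hcoordK x) chordal_toP1 ?hcoord_neq0 // [X in v (X - _)]mulrC subrr aval0 mul0r.
split.
  have [x fx] := lift_preimage d0 L (or_introl (erefl (Some 0))).
  have [y fy] := lift_preimage d0 L (or_intror (erefl None)).
  have xy : x <> y by move=> E; rewrite E fy in fx.
  apply: le_lt_trans (ratio x y xy); rewrite fx fy.
  have -> : chordal v (Some 0) None = 1.
    by rewrite /chordal /= mul0r mulr1 sub0r avalN aval1 aval0 max_r // max_l // mulr1 divr1.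
  by rewrite mul1r invf_ge1 ?chordal_gt0 // chordal_le1.
move=> x y; have [->|xy] := pselect (x = y); first by rewrite !c00 mulr0.
by rewrite -ler_pdivrMr ?chordal_gt0 // ltW ?ratio.
Qed.

Lemma ratiter_lift D f g phi n : (0 < D)%N -> is_lift D f g phi ->
  exists f' g', is_lift (D ^ n) f' g' (ratiter phi n).
Proof.
move=> D0 L; elim: n => [|n [f' [g' IH]]].
  by rewrite /ratiter /= -mobius1; do 2 eexists; apply: mobius_lift; apply: unitmx1.
have Dn0 : (0 < D ^ n)%N by rewrite expn_gt0 D0.
by do 2 eexists; rewrite expnS /ratiter iterS; apply: (lift_comp Dn0 L IH).
Qed.

Lemma chordal_lipschitz_ratiter D f g phi (M : R) n : (0 < D)%N -> is_lift D f g phi -> 0 <= M ->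
  chordal_lipschitz v M phi -> chordal_lipschitz v (M ^+ n) (ratiter phi n).
Proof.
move=> D0 L M0 H; elim: n => [|n IH] x y.
  by rewrite expr0 mul1r /ratiter /= -mobius1 !rat_eval_mobius1.
have [f' [g' L']] := ratiter_lift n D0 L.
have Dn0 : (0 < D ^ n)%N by rewrite expn_gt0 D0.
rewrite /ratiter iterS -/(ratiter phi n) !(rat_eval_comp _ Dn0 L L').
by apply: le_trans (H _ _) _; rewrite exprS -mulrA ler_wpM2l.
Qed.

End Lipschitz.

(** * The distance to the Gauss point *)

Theorem theorem1 (R : realType) (K : closedFieldType) (v : absval K R)
    (v_nontrivial : av_nontrivial v) (v_complete : av_complete v)
    (k : fieldType) (red : residue_map v k) (q : R) (q_gt1 : 1 < q)
    (p : nat) (K_char : has_char K 0) (k_char : has_char k p)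
    (phi : ratfun K) (phi_deg : (2 <= ratdeg phi)%N) :
  exists N0 : nat, forall Lt : R, (lipschitz_const v phi < Lt%:E)%E ->
    forall n : nat, (0 < n)%N -> (N0 <= n)%N ->
    forall P : berkP1 v, berkH1 P -> (0 < weight red (ratiter phi n) P)%N ->
      rho q P (zetaG v) < 3 * n%:R * logb q Lt.
Proof.
exists 0%N => Lt ltL n n0 _ P _ wP.
have d0 : (0 < ratdeg phi)%N by apply: leq_trans phi_deg.
have L := lift_rnum phi.
have [Lt1 lip] := lipschitz_const_lt d0 ltL; have Lt0 : 0 < Lt := lt_trans ltr01 Lt1.
pose M := Lt ^+ n.
have M1 : 1 < M by rewrite exprn_egt1 // -lt0n.
have lipM : chordal_lipschitz v M (ratiter phi n) := chordal_lipschitz_ratiter n d0 L (ltW Lt0) lip.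
have [f [g Ln]] := ratiter_lift n d0 L.
have Dn0 : (0 < ratdeg phi ^ n)%N by rewrite expn_gt0 d0.
have tP : is_typeII P.
  by move: wP; rewrite /weight; case: asboolP.
have lq : 0 < ln q by apply: ln_gt0.
have lL : 0 < ln Lt by apply: ln_gt0.
have n0R : 0 < n%:R :> R by rewrite ltr0n.
apply: le_lt_trans (rho_zetaG_le v_nontrivial q P) _.
have pos : 0 < n%:R * ln Lt / ln q by rewrite divr_gt0 // mulr_gt0.
(* The logarithmic form of diam P >= M^-2. *)
have bound d : 0 < d -> d <= 1 -> 1 <= d * M ^+ 2 -> `|logb q d| < 3 * n%:R * logb q Lt.
  move=> d00 d1 dM; have lnd : ln d <= 0 by apply: ln_le0.
  rewrite /logb ler0_norm; last by rewrite mulr_le0_ge0 // invr_ge0 ltW.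
  have : 0 <= ln (d * M ^+ 2) by apply: ln_ge0.
  have Mp : 0 < M := lt_trans ltr01 M1.
  rewrite lnM ?posrE ?exprn_gt0 // /M -exprM lnXn // mulrnA.
  rewrite -[_ *+ 2]mulr_natl -[ln Lt *+ n]mulr_natl => H.
  have -> : - (ln d / ln q) = - ln d / ln q by rewrite mulNr.
  have -> : 3 * n%:R * (ln Lt / ln q) = (3 * (n%:R * ln Lt)) / ln q by ring.
  rewrite ltr_pM2r ?invr_gt0 //; have := mulr_gt0 n0R lL.
  lra.
have [->|[b [c [c0 b1 c1 -> PE]]]] := diam_typeII v_nontrivial tP.
  rewrite /logb ln0 // mul0r normr0 -mulrA mulr_gt0 //.
  by rewrite mulrA.
apply: bound => //; first by rewrite aval_gt0.
rewrite leNgt; apply/negP => cM; move: wP; rewrite lt0n; case/negP; apply/eqP.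
have affE : affine_mx c b = affine_mx 1 b *m affine_mx c 0.
  by rewrite mul_mx2 /affine_mx; apply: eq_mx2; rewrite !mx2E; ring.
have Gb : GL2O v (affine_mx 1 b).
  split=> [i j|]; last by rewrite det_mx2 mulr1 mulr0 subr0 aval1.
  by case: (ord2P i) => ->; case: (ord2P j) => ->; rewrite mx2E ?aval0 ?aval1.
have Gw : GL2O v (winv K *m affine_mx 1 b).
  rewrite mul_mx2; split=> [i j|].
    case: (ord2P i) => ->; case: (ord2P j) => ->; rewrite !mx2E;
    by rewrite ?mul0r ?mul1r ?mulr0 ?mulr1 ?addr0 ?add0r ?aval0 ?aval1.
  by rewrite det_mx2 !mx2E !mul0r !mul1r !add0r !addr0 mul0r mulr1 sub0r avalN aval1.
case: PE => PE.
  by apply: (weight_eq0 v_nontrivial red Dn0 Ln lipM M1 Gb c0 cM tP); rewrite -affE.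
apply: (weight_eq0 v_nontrivial red Dn0 Ln lipM M1 Gw c0 cM tP).
by rewrite -mulmxA -affE.
Qed.
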